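(* Suppose $S\in\mathbb R^{d\times d}$ is nonnegative and irreducible, and let $m(z)=(m_1(z),\dots,m_d(z))$ be the solution of the Dyson equation with data $(S,\mathbf a)$. For each $j\in\{1,\dots,d\}$: (1) The singular set $$\mathcal A_j:=\Big\{\tau\in\mathbb R:\lim_{\eta\downarrow0}|m_j(\tau+\mathrm i\eta)|=\infty\Big\}=\Big\{\tau\in\mathbb R:\lim_{\eta\downarrow0}\operatorname{Im} m_j(\tau+\mathrm i\eta)=\infty\Big\}$$ (the two sets are equal) is finite. For every $\tau\notin\mathcal A_j$ the boundary value $m_j(\tau):=\lim_{\eta\downarrow0}m_j(\tau+\mathrm i\eta)$ exists and is finite. In particular, if $m(z)$ is uniformly bounded on $\mathbb C_+$, then each component $m_i$ admits a unique continuous extension to $\overline{\mathbb C_+}$. (2) There is a finite collection of real numbers $\{\tau_{j,k}\}_{k=1}^{N_j}\subset\mathcal A_j$ such that $$\tilde v_j(\mathrm d\tau)=v_j(\tau)\,\mathrm d\tau+\sum_{k=1}^{N_j}\Delta_{j,k}\,\delta_{\tau_{j,k}}(\mathrm d\tau),$$ where the atomic weights $\Delta_{j,k}$ and the possibly $\infty$-valued density $v_j(\tau)$ are determined by $$\Delta_{j,k}:=\lim_{\eta\downarrow0}\eta\operatorname{Im}m_j(\tau_{j,k}+\mathrm i\eta),\qquad v_j(\tau):=\frac1\pi\lim_{\eta\downarrow0}\operatorname{Im}\Big(m_j(\tau+\mathrm i\eta)-\sum_{k=1}^{N_j}\frac{\Delta_{j,k}}{\tau_{j,k}-(\tau+\mathrm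 i\eta)}\Big).$$ (3) Define $\mathcal A:=\bigcup_{j=1}^d\mathcal A_j$ and the regular support $\mathfrak S_j:=\{\tau\notin\mathcal A: v_j(\tau)>0\}$. Then $v_j$ is continuous on $\mathfrak S_j$. Moreover $\mathfrak S_j$ is independent of $j$; writing $\mathfrak S$ for the common set, $\mathfrak S$ is a finite union of open intervals.
   Context: $\mathbb C_+=\{z\in\mathbb C:\operatorname{Im}z>0\}$. Let $d\ge1$, let $S=(s_{ij})\in\mathbb R^{d\times d}$ have nonnegative entries and let $\mathbf a=(a_i)\in\mathbb R^d$. $S$ is irreducible if for all $i,j$ there is $n\ge1$ with $(S^n)_{ij}>0$. For each $z\in\mathbb C_+$ the Dyson equation $$-\frac1{m_i(z)}=z-a_i+\sum_{j=1}^d s_{ij}m_j(z),\qquad i=1,\dots,d,$$ has a unique solution $m(z)\in\mathbb C_+^d$ (known); $z\mapsto m(z)$ is analytic on $\mathbb C_+$, and for each $i$ there is a unique probability measure $\tilde v_i$ on $\mathbb R$ with $m_i(z)=\int_{\mathbb R}\frac{\tilde v_i(\mathrm d\tau)}{\tau-z}$ for $z\in\mathbb C_+$; it is supported in $[-\Sigma,\Sigma]$ with $\Sigma:=|\mathbf a|_2+2\|S\|_2^{1/2}$. *)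

(* Defs.v *)
From HB Require Import structures.
From mathcomp Require Import all_boot all_order all_algebra.
From mathcomp Require Import complex.
From mathcomp Require Import all_classical all_reals all_analysis.
From mathcomp Require Import measurable_realfun.
Import Normc.
Import Order.TTheory GRing.Theory Num.Theory.
Import numFieldNormedType.Exports.

Set Implicit Arguments.
Unset Strict Implicit.
Unset Printing Implicit Defensive.

Local Open Scope classical_set_scope.
Local Open Scope ring_scope.
Local Open Scope complex_scope.

Section Definitions.
Context {R : realType}.

(* [complex.Im] and [normc] are the [R]-valued imaginary part and modulus. The
   topology of the complex plane is that of the numFieldType [R[i]], which the
   library attaches to the alias [R[i]^o]. *)

Definition upper_half_plane : set R[i] := [set z | 0 < complex.Im z].

Definition closed_upper_half_plane : set R[i]^o :=
  [set z | 0 <= complex.Im z].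

Section Data.
Variable d : nat.
Implicit Types (S : 'M[R]_d) (a : 'rV[R]_d) (m : R[i] -> 'rV[R[i]]_d).

Definition nonneg_mx S := forall i j, 0 <= S i j.

Definition irreducible_mx S :=
  forall i j, exists2 n : nat, (1 <= n)%N & 0 < (S ^+ n) i j.

Definition dyson_solution S a m :=
  forall z, upper_half_plane z ->
    (forall i, upper_half_plane (m z 0 i)) /\
    (forall i, - (1 / m z 0 i) =
       z - (a 0 i)%:C + \sum_(j < d) (S i j)%:C * m z 0 j).

End Data.

(* Integral of a complex-valued function, by real and imaginary parts;
   meaningful when both are integrable, as they are for the bounded integrand
   of [stieltjes] off the real axis. *)
Definition cintegral (mu : probability (measurableTypeR R) R) (f : R -> R[i])
    : R[i] :=
  (\int[mu]_t complex.Re (f t)) +i* (\int[mu]_t complex.Im (f t)).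

Definition stieltjes (mu : probability (measurableTypeR R) R) (z : R[i]) :=
  cintegral mu (fun t => 1 / (t%:C - z)).

Section Boundary.
Variable f : R[i] -> R[i].

Definition sing_set : set R :=
  [set t | normc (f (t +i* eta)) @[eta --> 0^'+] --> +oo].

Definition im_sing_set : set R :=
  [set t | complex.Im (f (t +i* eta)) @[eta --> 0^'+] --> +oo].

Definition has_boundary_value (t : R) :=
  exists l : R[i]^o, (f (t +i* eta) : R[i]^o) @[eta --> 0^'+] --> l.

Definition continuous_extension (g : R[i]^o -> R[i]^o) :=
  {within closed_upper_half_plane, continuous g} /\
  (forall z, upper_half_plane z -> g z = f z).

Definition scaled_im (t eta : R) : R := eta * complex.Im (f (t +i* eta)).

Definition atom_weight (t : R) : R := lim (scaled_im t eta @[eta --> 0^'+]).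

(* [ts] lists the locations of the subtracted poles. *)
Definition im_without_poles (ts : seq R) (t eta : R) : R :=
  complex.Im (f (t +i* eta)
    - \sum_(s <- ts) (atom_weight s)%:C / (s%:C - (t +i* eta))).

(* The limit is taken in the extended reals, so that the value +oo is allowed. *)
Definition density (ts : seq R) (t : R) : \bar R :=
  ((pi^-1)%:E * lim ((im_without_poles ts t eta)%:E @[eta --> 0^'+]))%E.

(* [mu] is the sum of a density and of atoms at the points of [ts], the limits
   defining both being required to exist: a finite one for each weight, one in
   the extended reals for the density, which takes values in [0, +oo]. *)
Definition density_atoms_decomposition
    (mu : probability (measurableTypeR R) R) (ts : seq R) :=
  [/\ forall t, t \in ts -> cvg (scaled_im t eta @[eta --> 0^'+]),
      forall t, cvg ((im_without_poles ts t eta)%:E @[eta --> 0^'+]),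
      forall t, (0 <= density ts t)%E,
      measurable_fun [set: measurableTypeR R] (density ts) &
      forall B : set (measurableTypeR R), measurable B ->
        mu B = (\int[lebesgue_measure]_(t in B) density ts t
                + \sum_(s <- ts) (atom_weight s)%:E * \d_s B)%E].

End Boundary.

Definition regular_support (sing : set R) (v : R -> \bar R) : set R :=
  [set t | ~ sing t /\ (0 < v t)%E].

Definition finite_union_open_intervals (A : set R) :=
  exists I : seq (interval R),
    (forall i, i \in I -> open [set` i]) /\
    A = \bigcup_(i in [set` I]) [set` i].

End Definitions.

(* Main.v *)
(** Each component [m_j] is algebraic over [C(z)].  To see this, replace [S] by
    [S + eps (1 - S)].  As soon as all principal minors of this matrix are
    invertible, the algebra defined by the Dyson equations is spanned by the
    squarefree monomials, so multiplication by the [j]-th unknown has a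
    characteristic polynomial [chi] annihilating this unknown.  Since the Jacobian
    at [m(z)] is invertible, [m(z)] extends to a formal solution in powers of
    [eps], and the lowest order coefficient of [chi] in [eps] annihilates [m_j].

    Near a boundary point an algebraic function avoids all but finitely many
    circles around any given center; by connectedness it has a limit on the Riemann
    sphere.  The limit is infinite only at roots of a leading coefficient.  The
    same argument applies to [Im m_j] on vertical lines, which is algebraic too.
    If [Im m_j] stayed bounded at a singularity, [m_j] would grow at most
    logarithmically along the vertical line, too slowly for an algebraic function.

    The decomposition of the measure is Stieltjes inversion on intervals without
    singularities.  On the real line [Im m_j] satisfies a polynomial equation,
    which isolates its zero set away from finitely many points; that the supports
    do not depend on [j] follows from the imaginary part of the Dyson equation at
    the boundary and irreducibility. *)

Require Import Defs.
From HB Require Import structures.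
From mathcomp Require Import all_boot all_order all_algebra.
From mathcomp Require Import complex polyXY.
From mathcomp Require Import all_classical all_reals all_analysis.
From mathcomp Require Import measurable_realfun.
From mathcomp Require Import ring lra.
Import Normc.
Import Order.TTheory GRing.Theory Num.Theory.
Import numFieldNormedType.Exports.
Set Implicit Arguments.
Unset Strict Implicit.
Unset Printing Implicit Defensive.
Local Open Scope classical_set_scope.
Local Open Scope ring_scope.
Local Open Scope complex_scope.

(** * Elimination of the unknowns *)

Section Elimination.
Context {A : comNzRingType} {d : nat}.
Implicit Types (T : 'M[A]_d) (b : 'I_d -> A) (X Y Z : {set 'I_d}).

(** The homotopy is forced by degenerate [S]: as soon as one principal minor of [S] vanishes, for
    instance a diagonal entry, the characteristic polynomial is identically zero at parameter 0 and
    says nothing about [m_j]. At parameter 1 the matrix is the identity, all of whose principal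
    minors are 1, so the polynomial is nonzero as a polynomial in the parameter. If its zero at
    parameter 0 has order [k], a solution modulo order [k + 1] is enough to identify the surviving
    coefficient; neither power series nor convergence is needed. This part is pure algebra over a
    field, and the positivity of [Im m] enters only through the invertibility of the Jacobian. The
    boundary behaviour is obtained without Puiseux expansions. Only two properties of a component
    are used: a nonzero annihilating polynomial, and Lipschitz bounds on the half-planes
    [Im z >= c], which come from the Stieltjes representation. An exceptional circle is one that
    passes through a root of the polynomial specialised at the boundary point. *)

Definition principal_mx T X : 'M[A]_d :=
  \matrix_(i, j) (if i \in X then T i j *+ (j \in X) else (i == j)%:R).

(** [principal_mx T X] completes the block of [T] on [X] by rows of the identity, so its determinant
    is the principal minor at [X] while the index type stays fixed. Multiplying by all minors at
    once avoids denominators. *)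
Definition minor_prod T : A := \prod_(X : {set 'I_d}) \det (principal_mx T X).

(* With [w^Y] for the product of the [w i], [i] in [Y], the coefficient of [w^Y]
   when the [i]-th equation times [w^(X - i)] is solved for the terms
   [T i l w_l w^X] with [l] in [X]; these are the ones that are not squarefree. *)
Definition reduction_coef T b X (i : 'I_d) Y : A :=
  if i \in X then
    - (\sum_(l | l \notin X) T i l *+ (Y == l |: X)) - b i *+ (Y == X)
      - (Y == X :\ i)%:R
  else 0.

Definition mult_coef T b (j : 'I_d) X Y : A :=
  if j \in X then
    (\prod_(Z | Z != X) \det (principal_mx T Z)) *
      \sum_i (\adj (principal_mx T X)) j i * reduction_coef T b X i Y
  else minor_prod T *+ (Y == j |: X).

Definition mult_mx T b (j : 'I_d) : 'M[A]_#|{set 'I_d}| :=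
  \matrix_(p, q) mult_coef T b j (enum_val p) (enum_val q).

Lemma sum_pick (I : finType) (F : I -> A) (x : I) (c : A) :
  \sum_y (c *+ (y == x)) * F y = c * F x.
Proof.
rewrite (bigD1 x) //= eqxx mulr1n big1 ?addr0 // => y yx.
by rewrite (negPf yx) mulr0n mul0r.
Qed.

(** If [j] is not in [X], the product is squarefree already. Otherwise the products of [w l] with
    the monomial of [X], for [l] in [X], solve a linear system modulo [g] with matrix
    [principal_mx T X]; the adjugate solves it by Cramer's rule, and the other minors complete the
    common factor [minor_prod T]. *)
Lemma mult_coefP T b (w h : 'I_d -> A) (g : A) j X :
  (forall i, w i * (b i + \sum_l T i l * w l) + 1 = g * h i) ->
  exists q, minor_prod T * w j * \prod_(i in X) w i =
    \sum_Y mult_coef T b j X Y * \prod_(i in Y) w i + g * q.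
Proof.
move=> Hw; rewrite /mult_coef; case: (boolP (j \in X)) => [jX|jNX]; last first.
  exists 0; rewrite sum_pick mulr0 addr0 big_setU1 ?jNX //=; ring.
set e := fun Y => \prod_(i in Y) w i.
pose Xv : 'cV[A]_d := \col_l (e X * w l *+ (l \in X)).
pose rho : 'cV[A]_d := \col_i \sum_Y reduction_coef T b X i Y * e Y.
pose er : 'cV[A]_d := \col_i (if i \in X then h i * e (X :\ i) else 0).
have HX : principal_mx T X *m Xv = rho + g *: er.
  apply/matrixP => i k; rewrite {k}ord1 !mxE /reduction_coef.
  case: (boolP (i \in X)) => iX /=; last first.
    rewrite [X in _ = X + _]big1; last by move=> Y _; rewrite mul0r.
    rewrite mulr0 addr0.
    rewrite big1 // => l _; rewrite !mxE (negPf iX).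
    by case: eqP => [<-|_]; rewrite ?(negPf iX) ?mulr0 ?mul0r.
  rewrite (eq_bigr (fun Y => - (\sum_(l | l \notin X)
     (T i l *+ (Y == l |: X)) * e Y) + ((- b i) *+ (Y == X)) * e Y +
      ((-1) *+ (Y == X :\ i)) * e Y)); last first.
    move=> Y _; rewrite -mulr_suml !mulrDl; congr (_ + _ + _); first by rewrite mulNr.
      by rewrite -mulNrn.
    by rewrite mulNrn.
  rewrite !big_split /= !sum_pick sumrN exchange_big /=.
  rewrite [in RHS](eq_bigr (fun l => T i l * (e X * w l))); last first.
    move=> l lX; rewrite sum_pick /e big_setU1 //=; ring.
  rewrite [in LHS](eq_bigr (fun l => (T i l * (e X * w l)) *+ (l \in X))); last first.
    by move=> l _; rewrite !mxE iX; case: (l \in X); rewrite ?mulr1n ?mulr0n ?mulr0.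
  have Hs : \sum_l T i l * (e X * w l) = \sum_(l | l \notin X) T i l * (e X * w l)
      + \sum_l (T i l * (e X * w l)) *+ (l \in X).
    rewrite (bigID (mem X)) /= addrC; congr (_ + _).
    by rewrite big_mkcond; apply: eq_bigr => l _; case: (l \in X).
  have He : e X = w i * e (X :\ i) by rewrite /e (big_setD1 i).
  have := congr1 (fun x => x * e (X :\ i)) (Hw i).
  have Hs2 : \sum_l T i l * (e X * w l) = e X * \sum_l T i l * w l.
    by rewrite mulr_sumr; apply: eq_bigr => l _; ring.
  move: Hs; rewrite Hs2 => Hs.
  set s1 := \sum_(l | l \notin X) _ in Hs *.
  set s2 := \sum_l _ *+ _ in Hs *.
  set S0 := \sum_l T i l * w l in Hs *.
  move=> H.
  have -> : s2 = e X * S0 - s1 by rewrite Hs; ring.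
  have -> : g * (h i * e (X :\ i)) = g * h i * e (X :\ i) by ring.
  rewrite -H He; ring.
exists ((\prod_(Z | Z != X) \det (principal_mx T Z)) *
   ((\adj (principal_mx T X)) *m er) j 0).
have := congr1 (fun M => ((\adj (principal_mx T X)) *m M) j 0) HX.
rewrite mulmxA mul_adj_mx mul_scalar_mx mulmxDr -scalemxAr.
have addE (M N : 'cV[A]_d) c : (M + c *: N) j 0 = M j 0 + c * N j 0.
  by rewrite !mxE.
rewrite [LHS]mxE [Xv j 0]mxE jX mulr1n addE [X in _ = X + _]mxE => H.
rewrite /minor_prod (bigD1 X) //=.
rewrite [in RHS](eq_bigr (fun Y => (\prod_(Z | Z != X) \det (principal_mx T Z)) *
   (\sum_i (\adj (principal_mx T X)) j i * reduction_coef T b X i Y * e Y))); last first.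
  by move=> Y _; rewrite -mulrA mulr_suml.
rewrite -mulr_sumr exchange_big /=.
have -> : \sum_i \sum_(Y : {set 'I_d})
      (\adj (principal_mx T X)) j i * reduction_coef T b X i Y * e Y
   = \sum_i (\adj (principal_mx T X)) j i * rho i 0.
  by apply: eq_bigr => i _; rewrite [rho _ _]mxE mulr_sumr; apply: eq_bigr => Y _; ring.
rewrite [g * (_ * _)]mulrCA -mulrDr -H -/(e X); ring.
Qed.

Lemma elimination_det T b (w h : 'I_d -> A) (g : A) j :
  (forall i, w i * (b i + \sum_l T i l * w l) + 1 = g * h i) ->
  exists q, \det ((minor_prod T * w j)%:M - mult_mx T b j) = g * q.
Proof.
move=> Hw.
have q X := mult_coefP j X Hw.
have /fin_all_exists [u Hu] := q.
pose e : 'cV[A]_#|{set 'I_d}| := \col_p \prod_(i in (enum_val p : {set 'I_d})) w i.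
pose M := (minor_prod T * w j)%:M - mult_mx T b j.
have HM : M *m e = g *: \col_p u (enum_val p).
  rewrite mulmxBl mul_scalar_mx; apply/matrixP => p k; rewrite {k}ord1 !mxE Hu.
  rewrite (reindex_onto (@enum_val _ (mem {set 'I_d})) enum_rank) /=; last first.
    by move=> Y _; rewrite enum_rankK.
  rewrite (eq_bigl predT); last by move=> k; rewrite enum_valK eqxx.
  rewrite [X in _ - X](eq_bigr (fun k => mult_coef T b j (enum_val p) (enum_val k) *
    \prod_(i in (enum_val k : {set 'I_d})) w i)); first by ring.
  by move=> k _; rewrite !mxE.
(* Modulo [g] the vector of squarefree monomials is in the kernel of [M]. Its entry at the empty set
   is 1, so the adjugate identity read there isolates the determinant. *)
exists ((\adj M *m \col_p u (enum_val p)) (enum_rank finset.set0) 0).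
have := congr1 (fun N => (\adj M *m N) (enum_rank finset.set0) 0) HM.
rewrite mulmxA mul_adj_mx mul_scalar_mx -scalemxAr.
by rewrite [LHS]mxE [e _ _]mxE enum_rankK big_set0 mulr1 [RHS]mxE.
Qed.

End Elimination.

Section EliminationMap.
Context {A B : comNzRingType} (f : {rmorphism A -> B}) {d : nat}.
Variables (T : 'M[A]_d) (b : 'I_d -> A).

Lemma map_principal_mx X :
  map_mx f (principal_mx T X) = principal_mx (map_mx f T) X.
Proof.
apply/matrixP => i j; rewrite !mxE; case: ifP => _; first by rewrite rmorphMn.
by rewrite rmorph_nat.
Qed.

Lemma map_minor_prod : f (minor_prod T) = minor_prod (map_mx f T).
Proof.
rewrite rmorph_prod; apply: eq_bigr => X _.
by rewrite -det_map_mx map_principal_mx.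
Qed.

Lemma map_mult_mx j : map_mx f (mult_mx T b j) = mult_mx (map_mx f T) (f \o b) j.
Proof.
apply/matrixP => p q; rewrite !mxE /mult_coef; case: ifP => _; last first.
  by rewrite rmorphMn map_minor_prod.
rewrite rmorphM rmorph_prod rmorph_sum; congr (_ * _).
  by apply: eq_bigr => Z _; rewrite -det_map_mx map_principal_mx.
apply: eq_bigr => i _; rewrite rmorphM -map_principal_mx -map_mx_adj [X in _ = X * _]mxE.
congr (_ * _); rewrite /reduction_coef; case: (boolP (i \in _)) => _ /=; last by rewrite rmorph0.
rewrite !rmorphB rmorphN rmorphMn rmorph_nat rmorph_sum.
congr (_ - _ - _); congr (- _).
by apply: eq_bigr => l _; rewrite mxE rmorphMn.
Qed.

End EliminationMap.

(** * Formal solutions in the homotopy parameter *)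

Definition homotopy_mx (A : comNzRingType) d (S : 'M[A]_d) (x : A) : 'M[A]_d :=
  S + x *: (1%:M - S).

Section Hensel.
Context {F : fieldType} {d : nat}.
Implicit Types (S : 'M[F]_d) (b m : 'I_d -> F).

(** Injectivity of the derivative at [m] of the map with components
    [w i * (b i + \sum_l S i l * w l) + 1]. *)
Definition nondegenerate S b m := forall h : 'I_d -> F,
  (forall i, h i * (b i + \sum_l S i l * m l) + m i * \sum_l S i l * h l = 0) ->
  forall i, h i = 0.

Lemma nondegenerate_surj S b m (r : 'I_d -> F) : nondegenerate S b m ->
  exists h : 'I_d -> F, forall i,
    h i * (b i + \sum_l S i l * m l) + m i * \sum_l S i l * h l = r i.
Proof.
move=> nd.
pose J : 'M[F]_d := \matrix_(l, i)
  ((b i + \sum_k S i k * m k) *+ (l == i) + m i * S i l).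
have JE (h : 'rV[F]_d) i : (h *m J) 0 i =
    h 0 i * (b i + \sum_l S i l * m l) + m i * \sum_l S i l * h 0 l.
  set c := b i + _; rewrite mxE (eq_bigr (fun l => (c * h 0 l) *+ (l == i)
    + m i * (S i l * h 0 l))); last first.
    by move=> l _; rewrite mxE -/c; case: (l == i); rewrite ?mulr1n ?mulr0n; ring.
  rewrite big_split /= -mulr_sumr; congr (_ + _).
  rewrite (bigD1 i) //= eqxx mulr1n big1 ?addr0 1?mulrC // => l /negPf->.
  by rewrite mulr0n.
have Ju : J \in unitmx.
  rewrite -row_free_unit; apply: inj_row_free => v vJ.
  apply/rowP => i; rewrite mxE; apply: (nd (fun i => v 0 i)) => k.
  by rewrite -JE vJ mxE.
exists (fun i => ((\row_k r k) *m invmx J) 0 i) => i.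
by rewrite -JE mulmxKV // mxE.
Qed.

(** One order is gained at a time. Since the homotopy matrix equals [S] at 0, a correction
    ['X^(n.+1) * h] changes the leading coefficient of the error by the derivative at [m] applied to
    [h], which is onto; the terms quadratic in the correction have higher order. *)
Lemma hensel S b m n :
  (forall i, m i * (b i + \sum_l S i l * m l) + 1 = 0) -> nondegenerate S b m ->
  exists w q : 'I_d -> {poly F}, (forall i, (w i).[0] = m i) /\
    forall i, w i * ((b i)%:P + \sum_l homotopy_mx (map_mx polyC S) 'X i l * w l) + 1
      = 'X^(n.+1) * q i.
Proof.
move=> Hm nd; set T := homotopy_mx _ _.
have div0 (p : {poly F}) : p.[0] = 0 -> {q | p = 'X * q}.
  move=> p0; have /factor_theorem/sig_eqW [q ->] : root p 0 by apply/eqP.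
  by exists q; rewrite subr0 mulrC.
have T0 i l : (T i l).[0] = S i l.
  by rewrite !mxE /= !hornerE ?mul0r ?addr0.
have row0 (w : 'I_d -> {poly F}) i :
    (\sum_l T i l * w l).[0] = \sum_l S i l * (w l).[0].
  rewrite horner_sum; apply: eq_bigr => l _; by rewrite hornerM T0.
elim: n => [|n [w [q [w0 wq]]]].
  exists (fun i => (m i)%:P).
  have H i : exists q, (m i)%:P * ((b i)%:P + \sum_l T i l * (m l)%:P) + 1 = 'X^1 * q.
    have [] := div0 ((m i)%:P * ((b i)%:P + \sum_l T i l * (m l)%:P) + 1); last first.
      by move=> q ->; exists q; rewrite expr1.
    rewrite hornerD hornerM hornerD row0 !hornerC -[RHS](Hm i).
    by under eq_bigr do rewrite hornerC.
  have /fin_all_exists [q Hq] := H.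
  by exists q; split => // i; rewrite hornerC.
have [h Hh] := nondegenerate_surj (fun i => - (q i).[0]) nd.
pose w' i := w i + 'X^(n.+1) * (h i)%:P.
exists w'.
have H i : exists q', w' i * ((b i)%:P + \sum_l T i l * w' l) + 1 = 'X^(n.+2) * q'.
  pose p := q i + (h i)%:P * ((b i)%:P + \sum_l T i l * w l)
     + w i * \sum_l T i l * (h l)%:P.
  have [] := div0 p.
    rewrite /p !hornerD !hornerM !hornerD !row0 !hornerC w0.
    under eq_bigr do rewrite w0.
    rewrite -addrA; under [X in _ + (_ + _ * X)]eq_bigr do rewrite hornerC.
    by rewrite Hh subrr.
  move=> p' Hp'.
  exists (p' + 'X^n * ((h i)%:P * \sum_l T i l * (h l)%:P)).
  have -> : \sum_l T i l * w' l = \sum_l T i l * w l + 'X^(n.+1) * \sum_l T i l * (h l)%:P.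
    by rewrite mulr_sumr -big_split /=; apply: eq_bigr => l _; rewrite /w'; ring.
  have -> : 'X^(n.+2) * (p' + 'X^n * ((h i)%:P * \sum_l T i l * (h l)%:P)) =
     'X^(n.+1) * p + 'X^(n.+1) * 'X^(n.+1) * ((h i)%:P * \sum_l T i l * (h l)%:P).
    by rewrite Hp' !exprS; ring.
  by rewrite /p !mulrDr -(wq i) /w'; ring.
have /fin_all_exists [q' Hq'] := H.
exists q'; split => // i.
by rewrite /w' hornerD hornerM hornerXn expr0n /= mul0r addr0.
Qed.

End Hensel.

Section Algebraic.
Context {F : fieldType} {d : nat}.
Variables (S : 'M[F]_d) (b : 'I_d -> {poly F}) (j : 'I_d).
Local Notation K := {poly {poly {poly F}}}.

(* The variables of K are, from the outside in, the homotopy parameter, the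
   unknown and the spectral parameter. *)
Let T : 'M[K]_d := homotopy_mx (map_mx (fun x => x%:P%:P%:P) S) 'X.
Let bK i : K := (b i)%:P%:P.
Let chi : K := \det ((minor_prod T * ('X)%:P)%:M - mult_mx T bK j).

Lemma minor_prod1 (A : comNzRingType) : minor_prod (1%:M : 'M[A]_d) = 1.
Proof.
rewrite /minor_prod big1 // => X _.
suff -> : principal_mx 1%:M X = 1%:M :> 'M[A]_d by rewrite det1.
apply/matrixP => i l; rewrite !mxE; case: ifP => // iX.
by case: eqP => [<-|_]; rewrite ?iX ?mulr1n // mulr0n mul0rn.
Qed.

(** With homotopy parameter 1 and spectral parameter 0 the matrix [T] becomes the identity and
    [minor_prod] becomes 1, so [chi] specialises to the characteristic polynomial of a matrix over
    [F], which is monic. *)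
Lemma chi_neq0 : chi != 0.
Proof.
pose f : {rmorphism K -> {poly F}} :=
  horner_eval 1 \o map_poly (map_poly (horner_eval 0)).
have fC u : f u%:P = map_poly (horner_eval 0) u.
  by rewrite /f /= map_polyC /= /horner_eval hornerC.
have fX : f 'X = 1 by rewrite /f /= map_polyX /horner_eval hornerX.
suff : f chi != 0 by apply: contra_neq => ->; rewrite rmorph0.
rewrite /chi -det_map_mx map_mxB map_mult_mx map_scalar_mx rmorphM map_minor_prod.
have -> : map_mx f T = 1%:M.
  apply/matrixP => i l; rewrite !mxE rmorphD rmorphM rmorphB rmorph_nat fX.
  by rewrite mul1r addrC subrK.
rewrite minor_prod1 mul1r fC map_polyX.
have -> : mult_mx 1%:M (f \o bK) j =
    map_mx polyC (mult_mx 1%:M (fun i => (b i).[0]) j).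
  rewrite map_mult_mx map_scalar_mx rmorph1.
  congr (mult_mx _ _ _); apply/funext => i.
  by rewrite -[LHS]/(f (b i)%:P%:P) fC map_polyC.
exact: monic_neq0 (char_poly_monic _).
Qed.

(* The lowest order coefficient of [chi] in the homotopy parameter survives the
   substitution of the formal solution given by [hensel]. *)
Lemma algebraic_solution : exists2 P : {poly {poly F}}, P != 0 &
  forall (z : F) (m : 'I_d -> F),
    (forall i, m i * ((b i).[z] + \sum_l S i l * m l) + 1 = 0) ->
    nondegenerate S (fun i => (b i).[z]) m ->
    P.[(m j)%:P].[z] = 0.
Proof.
have [k [chi' + chiE]] := multiplicity_XsubC chi 0.
rewrite chi_neq0 /= => chi'0.
exists chi'.[0] => // z m Hm nd.
(* The solution is taken modulo ['X^(k.+1)], one order beyond the power ['X^k] that is about to be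
   cancelled. *)
have [w [q [w0 wq]]] := hensel k Hm nd.
pose g : {rmorphism {poly {poly F}} -> {poly F}} :=
  horner_eval (w j) \o map_poly (polyC \o horner_eval z).
pose f : {rmorphism K -> {poly F}} := horner_eval 'X \o map_poly g.
have fC u : f u%:P = g u by rewrite /f /= map_polyC /= /horner_eval hornerC.
have fX : f 'X = 'X by rewrite /f /= map_polyX /horner_eval hornerX.
have gC u : g u%:P = u.[z]%:P by rewrite /g /= map_polyC /= /horner_eval hornerC.
have gX : g 'X = w j by rewrite /g /= map_polyX /horner_eval hornerX.
have fT : map_mx f T = homotopy_mx (map_mx polyC S) 'X.
  apply/matrixP => i l; rewrite !mxE rmorphD rmorphM rmorphB rmorph_nat fX.
  by rewrite !fC !gC hornerC.
have [u Hu] := elimination_det j wq.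
have : f chi = 'X^(k.+1) * u.
  rewrite -Hu /chi -det_map_mx map_mxB map_mult_mx map_scalar_mx rmorphM.
  rewrite map_minor_prod fT fC gX; congr (\det (_ - mult_mx _ _ _)).
  by apply/funext => i; rewrite -[LHS]/(f (b i)%:P%:P) fC gC.
rewrite chiE subr0 rmorphM rmorphXn fX exprSr mulrC -mulrA.
have Xk : 'X^k != 0 :> {poly F} by rewrite expf_neq0 // polyX_eq0.
move=> /(mulfI Xk) /(congr1 (fun p => p.[0])).
rewrite hornerM hornerX mul0r => <-.
pose g0 : {rmorphism {poly {poly F}} -> F} := horner_eval 0 \o g.
have -> : (f chi').[0] = g0 chi'.[0].
  rewrite -horner_map /f /= /horner_eval.
  rewrite -[LHS]/(horner_eval 0 _) -horner_map /= -map_poly_comp /=.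
  by rewrite /horner_eval hornerX map_poly0 !horner0.
set P := chi'.[0]; rewrite /g0 /g /= /horner_eval.
rewrite -[RHS]/(horner_eval 0 _) -horner_map /= -map_poly_comp /=.
rewrite /horner_eval w0 -[LHS]/(horner_eval z _) -horner_map /= /horner_eval hornerC.
by congr horner; apply: eq_map_poly => p /=; rewrite hornerC.
Qed.
End Algebraic.

(** * Limits of algebraic functions *)

Section ComplexNorm.
Context {R : realType}.
Implicit Types z w : R[i].

Lemma normc_ge0 z : 0 <= normc z.
Proof. by case: z => a b /=; rewrite sqrtr_ge0. Qed.

Lemma normcB z w : normc (z - w) = normc (w - z).
Proof. by rewrite -normcN opprB. Qed.

Lemma normc_gt0 z : z != 0 -> 0 < normc z.
Proof.
move=> z0; rewrite lt_neqAle normc_ge0 andbT eq_sym.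
by apply: contra_neq z0; exact: eq0_normc.
Qed.

Lemma sqr_normcE z : normc z ^+ 2 = complex.Re z ^+ 2 + complex.Im z ^+ 2.
Proof. by case: z => a b /=; rewrite sqr_sqrtr // addr_ge0 ?sqr_ge0. Qed.

Lemma Re_le_normc z : `|complex.Re z| <= normc z.
Proof.
rewrite -(@ler_pXn2r _ 2) ?nnegrE ?normc_ge0 // sqr_normcE real_normK ?num_real //.
by rewrite lerDl sqr_ge0.
Qed.

Lemma Im_le_normc z : `|complex.Im z| <= normc z.
Proof.
rewrite -(@ler_pXn2r _ 2) ?nnegrE ?normc_ge0 // sqr_normcE real_normK ?num_real //.
by rewrite lerDr sqr_ge0.
Qed.

Lemma normc_le z : normc z <= `|complex.Re z| + `|complex.Im z|.
Proof.
rewrite -(@ler_pXn2r _ 2) ?nnegrE ?normc_ge0 ?addr_ge0 // sqr_normcE sqrrD.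
rewrite !real_normK ?num_real // addrAC lerDl.
by rewrite mulrn_wge0 ?mulr_ge0.
Qed.

Lemma normcR (x : R) : normc x%:C = `|x|.
Proof. by rewrite /normc /= expr0n addr0 sqrtr_sqr. Qed.

Lemma normcX z n : normc (z ^+ n) = normc z ^+ n.
Proof. by elim: n => [|n IH]; rewrite ?expr0 ?normc1 // !exprS normcM IH. Qed.

Lemma normc_prod (s : seq R[i]) (f : R[i] -> R[i]) :
  normc (\prod_(i <- s) f i) = \prod_(i <- s) normc (f i).
Proof.
by elim: s => [|x s IH]; rewrite ?big_nil ?normc1 // !big_cons normcM IH.
Qed.

Lemma ler_normcB z w : `|normc z - normc w| <= normc (z - w).
Proof.
have H (u v : R[i]) : normc u - normc v <= normc (u - v).
  by rewrite lerBlDr; apply: le_trans (le_normcD _ _); rewrite subrK.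
by rewrite ler_norml H lerNl opprB (le_trans (H _ _)) // normcB.
Qed.

End ComplexNorm.

Section PolyBounds.
Context {R : realType}.
Local Notation C := R[i].

Lemma poly_growth (p : {poly C}) : exists K : R, exists n : nat, 0 <= K /\
  forall w, normc p.[w] <= K * (1 + normc w) ^+ n.
Proof.
elim/poly_ind: p => [|p c [K [n [K0 H]]]].
  by exists 0, 0%N; split => // w; rewrite horner0 normc0 mul0r.
exists (K + normc c), n.+1; split; first by rewrite addr_ge0 ?normc_ge0.
move=> w; rewrite hornerMXaddC (le_trans (le_normcD _ _)) // mulrDl.
have w0 := normc_ge0 w.
have w1 : 1 <= 1 + normc w by rewrite lerDl.
apply: lerD; last by rewrite ler_peMr ?normc_ge0 // exprn_ege1.
rewrite normcM exprSr mulrA; apply: ler_pM; rewrite ?normc_ge0 //.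
by rewrite lerDr.
Qed.

(* Here and below the outer variable of a bivariate polynomial is the spectral
   parameter and the inner one is the unknown. *)
Lemma poly2_growth (P : {poly {poly C}}) (z0 : C) :
  exists K : R, exists n : nat, 0 <= K /\
  forall z w, normc (z - z0) <= 1 -> normc P.[z%:P].[w] <= K * (1 + normc w) ^+ n.
Proof.
elim/poly_ind: P => [|P p [K [n [K0 H]]]].
  by exists 0, 0%N; split => // z w _; rewrite horner0 horner0 normc0 mul0r.
have [K' [n' [K'0 H']]] := poly_growth p.
have a0 : 0 <= 1 + normc z0 by rewrite addr_ge0 ?normc_ge0.
exists (K * (1 + normc z0) + K'), (n + n')%N; split.
  by rewrite addr_ge0 // mulr_ge0.
move=> z w zz0; rewrite hornerMXaddC hornerD (le_trans (le_normcD _ _)) // mulrDl.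
have w0 := normc_ge0 w.
have w1 : 1 <= 1 + normc w by rewrite lerDl.
apply: lerD.
  rewrite hornerM hornerC normcM mulrAC; apply: ler_pM; rewrite ?normc_ge0 //.
    apply: (le_trans (H _ _ zz0)); apply: ler_wpM2l => //.
    by rewrite exprD ler_peMr ?exprn_ge0 ?addr_ge0 // exprn_ege1.
  rewrite -[z](subrK z0) (le_trans (le_normcD _ _)) //.
  by rewrite lerD2r.
apply: (le_trans (H' _)); apply: ler_wpM2l => //.
by rewrite exprD ler_peMl ?exprn_ge0 ?addr_ge0 // exprn_ege1.
Qed.

(** The factor theorem in the spectral parameter makes the difference quotient a polynomial. Its
    growth in [w] is kept explicit because the lemma is also applied where [w] is unbounded. *)
Lemma poly2_lipschitz (P : {poly {poly C}}) (z0 : C) :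
  exists K : R, exists n : nat, 0 <= K /\
  forall z w, normc (z - z0) <= 1 ->
    normc (P.[z%:P].[w] - P.[z0%:P].[w]) <= K * normc (z - z0) * (1 + normc w) ^+ n.
Proof.
have /factor_theorem [Q PQ] : root (P - P.[z0%:P]%:P) z0%:P.
  by rewrite /root hornerD hornerN hornerC subrr.
have [K [n [K0 H]]] := poly2_growth Q z0.
exists K, n; split => // z w zz0.
have -> : P.[z%:P].[w] - P.[z0%:P].[w] = Q.[z%:P].[w] * (z - z0).
  have := congr1 (fun p => p.[z%:P].[w]) PQ.
  by rewrite !hornerE.
rewrite normcM -mulrA [_ * _ ^+ n]mulrC mulrA ler_wpM2r ?normc_ge0 //.
exact: H.
Qed.

(** The specialisation at [z0] may vanish identically; dividing by the full power of [z - z0]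
    repairs this and loses no information at [z != z0]. *)
Lemma poly2_normalize (F : fieldType) (P : {poly {poly F}}) (z0 : F) : P != 0 ->
  exists2 P' : {poly {poly F}}, P'.[z0%:P] != 0 &
    forall z w, z != z0 -> P.[z%:P].[w] = 0 -> P'.[z%:P].[w] = 0.
Proof.
move=> P0; have [k [P' + PE]] := multiplicity_XsubC P z0%:P.
rewrite P0 /= => P'0; exists P' => // z w zz0; rewrite PE.
move=> /eqP; rewrite hornerM horner_exp hornerXsubC -polyCB -polyC_exp hornerM.
rewrite hornerC mulf_eq0 expf_eq0 subr_eq0 (negPf zz0) andbF orbF.
exact: eqP.
Qed.

End PolyBounds.

Section Dichotomy.
Context {R : realType}.
Local Notation C := R[i].
Variables (D : set C) (z0 : C).

Definition near_point (A : C -> Prop) :=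
  exists2 e : R, 0 < e & forall z, D z -> normc (z - z0) < e -> A z.

Lemma near_point_and A B : near_point A -> near_point B -> near_point (fun z => A z /\ B z).
Proof.
move=> [e e0 eA] [e' e'0 eB]; exists (Num.min e e'); first by rewrite lt_min e0.
by move=> z Dz; rewrite lt_min => /andP[? ?]; split; [apply: eA|apply: eB].
Qed.

Lemma near_point_sub (A B : C -> Prop) : (forall z, D z -> A z -> B z) -> near_point A -> near_point B.
Proof. by move=> AB [e e0 eA]; exists e => // z Dz ez; apply: AB => //; apply: eA. Qed.

Lemma avoid_seq (s : seq R) (a b : R) : a < b ->
  exists2 x, a < x < b & x \notin s.
Proof.
elim: s a b => [|e s IH] a b ab.
  by exists ((a + b) / 2); rewrite ?midf_lt.
have [h1 h2] := midf_lt ab; set c := (a + b) / 2 in h1 h2.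
have [ec|ec] := leP e c.
  have [x /andP[cx xb] xs] := IH c b h2.
  exists x; first by rewrite (lt_trans h1 cx).
  by rewrite inE negb_or xs andbT gt_eqF // (le_lt_trans ec).
have [x /andP[ax xc] xs] := IH a c h1.
exists x; first by rewrite ax (lt_trans xc).
by rewrite inE negb_or xs andbT lt_eqF // (lt_trans xc).
Qed.

(** The limit is the infimum of the eventual upper bounds. A level slightly below it and outside [s]
    is not an eventual upper bound, hence it is an eventual lower bound. *)
Lemma threshold_limit (g : C -> R) (s : seq R) :
  (forall z, 0 <= g z) ->
  (forall r, 0 <= r -> r \notin s -> near_point (fun z => g z < r) \/ near_point (fun z => r < g z)) ->
  (exists2 r, 0 <= r & near_point (fun z => g z < r)) ->
  exists l, forall e, 0 < e -> near_point (fun z => `|g z - l| < e).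
Proof.
move=> g0 H [r0 r00 Hr0].
pose E := [set r | 0 <= r /\ near_point (fun z => g z < r)].
have Einf : has_inf E by split; [exists r0|exists 0 => r []].
exists (inf E) => e e0.
have [r [r_ge0 Er] re] := inf_adherent e0 Einf.
have lower : near_point (fun z => inf E - e < g z).
  have [le0|le0] := ltP (inf E - e) 0.
    by exists 1 => // z _ _; apply: lt_le_trans (g0 z).
  have [|x /andP[xe xl] xs] := @avoid_seq s (inf E - e) (inf E); first by lra.
  have x0 : 0 <= x by apply: le_trans (ltW xe).
  case: (H x x0 xs) => Hx; last by apply: near_point_sub Hx => z _; apply: lt_trans.
  have : inf E <= x by apply: ge_inf; [case: Einf|split].
  by rewrite leNgt xl.
apply: near_point_sub (near_point_and Er lower) => z _ [h1 h2].
rewrite ltr_norml; lra.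
Qed.

Variable f : C -> C.

(** A substitute for continuity, sufficient for the intermediate value theorem along segments; the
    constant may depend on the segment. *)
Definition segment_lipschitz := forall z1 z2, D z1 -> D z2 ->
  exists L : R, forall s t : R, 0 <= s <= 1 -> 0 <= t <= 1 ->
    normc (f (z1 + s%:C * (z2 - z1)) - f (z1 + t%:C * (z2 - z1))) <= L * `|s - t|.

Definition segment_convex := forall z1 z2 (s : R), D z1 -> D z2 -> 0 <= s <= 1 ->
  D (z1 + s%:C * (z2 - z1)).

Lemma lipschitz01_ivt (g : R -> R) (L v : R) :
  (forall s t, 0 <= s <= 1 -> 0 <= t <= 1 -> `|g s - g t| <= L * `|s - t|) ->
  g 0 <= v <= g 1 -> exists2 s, 0 <= s <= 1 & g s = v.
Proof.
move=> gL /andP[v0 v1].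
have gc : {within `[0, 1], continuous g}.
  (* Composition with the retraction [k] onto [[0, 1]] extends [g] to a function continuous on the
     whole line. *)
  pose k (s : R) := Num.min 1 (Num.max 0 s).
  have k01 s : 0 <= k s <= 1.
    by rewrite /k ge_min le_min lexx ler01 le_max lexx.
  have kE s : 0 <= s <= 1 -> k s = s.
    by move=> /andP[h1 h2]; rewrite /k max_r // min_r.
  have kL s t : `|k s - k t| <= `|s - t|.
    rewrite /k /Num.min /Num.max.
    repeat case: ifPn; rewrite -?leNgt => *; rewrite ler_norml;
      have := ler_norm (s - t); have := ler_norm (t - s); rewrite (distrC t); lra.
  have L0 : 0 <= L.
    have := gL 0 1; rewrite !lexx !ler01 => /(_ isT isT).
    by rewrite sub0r normrN normr1 mulr1; apply: le_trans.
  have gk : continuous (g \o k).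
    move=> x; apply/cvgrPdist_lt => e e0.
    near=> t; rewrite /=.
    apply: le_lt_trans (gL _ _ (k01 x) (k01 t)) _.
    apply: (@le_lt_trans _ _ ((L + 1) * `|x - t|)).
      by apply: ler_pM => //; rewrite ?lerDl.
    rewrite -ltr_pdivlMl; last by rewrite ltr_wpDl.
    near: t; apply: cvgr_dist_lt => //.
      by rewrite mulr_gt0 // invr_gt0 ltr_wpDl.
  have /continuous_subspaceT := gk => /(_ `[0, 1]%classic).
  apply: subspace_eq_continuous => x; rewrite inE /= in_itv /= => x01.
  by rewrite /from_subspace /= kE.
have [|c] := IVT (@ler01 R) gc (_ : _ <= v <= _).
  by rewrite ge_min v0 /= le_max v1 orbT.
by rewrite in_itv /= => c01 gcv; exists c.
Unshelve. all: by end_near. Qed.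


(** On the circle, each linear factor of [Q] is bounded below by the distance of its root to the
    circle, by the reverse triangle inequality. *)
Lemma circle_lower_bound (Q : {poly C}) (r : C) (t : R) : Q != 0 -> 0 <= t ->
  (forall x, root Q x -> normc (x - r) != t) ->
  exists2 c : R, 0 < c & forall w, normc (w - r) = t -> c <= normc Q.[w].
Proof.
move=> Q0 t0 Ht; have [rs Qrs] := closed_field_poly_normal Q.
have lc0 : lead_coef Q != 0 by rewrite lead_coef_eq0.
exists (normc (lead_coef Q) * \prod_(x <- rs) `|t - normc (x - r)|).
  rewrite mulr_gt0 ?normc_gt0 // big_seq prodr_gt0 // => x xrs.
  rewrite normr_gt0 subr_eq0 eq_sym Ht // Qrs rootZ //.
  by rewrite root_prod_XsubC.
move=> w wr; rewrite [in leRHS]Qrs hornerZ normcM ler_wpM2l ?normc_ge0 //.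
rewrite horner_prod normc_prod ler_prod // => x _.
rewrite hornerXsubC normr_ge0 /= -wr.
have -> : w - x = (w - r) - (x - r) by rewrite opprB addrA subrK.
exact: ler_normcB.
Qed.

Hypothesis (f_lip : segment_lipschitz) (D_convex : segment_convex).
Hypothesis (Dz0 : ~ D z0).

(** Points of [D] near [z0] with values on both sides of [v] are joined by a segment that stays in
    [D] and near [z0]; the value [v] would be taken on it. *)
Lemma near_point_side (g : C -> R) (v : R) :
  (forall z1 z2, D z1 -> D z2 -> exists L : R, forall s t : R,
    0 <= s <= 1 -> 0 <= t <= 1 ->
    `|g (z1 + s%:C * (z2 - z1)) - g (z1 + t%:C * (z2 - z1))| <= L * `|s - t|) ->
  near_point (fun z => g z != v) -> near_point (fun z => g z < v) \/ near_point (fun z => v < g z).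
Proof.
move=> gL [e e0 eg].
have [[z1 [Dz1 ez1]]|noz] := pselect (exists z1, D z1 /\ normc (z1 - z0) < e); last first.
  by left; exists e => // z Dz ez; case: noz; exists z.
have key z z' : D z -> normc (z - z0) < e -> D z' -> normc (z' - z0) < e ->
    g z < v -> ~ v < g z'.
  move=> Dz ez Dz' ez' gz gz'.
  have [L HL] := gL _ _ Dz Dz'.
  have [|s s01 gs] := @lipschitz01_ivt (fun s => g (z + s%:C * (z' - z))) L v HL.
    by rewrite mul0r addr0 mul1r [z + _]addrC subrK !ltW.
  have := eg (z + s%:C * (z' - z)) (D_convex Dz Dz' s01).
  rewrite gs eqxx; suff H : normc (z + s%:C * (z' - z) - z0) < e by move=> /(_ H).
  have -> : z + s%:C * (z' - z) - z0 = (1 - s)%:C * (z - z0) + s%:C * (z' - z0).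
    by rewrite rmorphB rmorph1; ring.
  apply: le_lt_trans (le_normcD _ _) _; rewrite !normcM !normcR.
  case/andP: s01 => s0 s1; rewrite !ger0_norm ?subr_ge0 //.
  have [->|sn0] := eqVneq s 0; first by rewrite subr0 mul1r mul0r addr0.
  have {sn0 s0} s0 : 0 < s by rewrite lt_neqAle eq_sym sn0.
  have : (1 - s) * normc (z - z0) <= (1 - s) * e by rewrite ler_wpM2l ?subr_ge0 // ltW.
  have : s * normc (z' - z0) < s * e by rewrite ltr_pM2l.
  lra.
have := eg _ Dz1 ez1; case: ltgtP => // gz1 _.
  left; exists e => // z Dz ez; have := eg _ Dz ez; case: ltgtP => // gz _.
  by case: (key z1 z).
right; exists e => // z Dz ez; have := eg _ Dz ez; case: ltgtP => // gz _.
by case: (key z z1).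
Qed.

(** The exceptional levels are the squared distances from [r] to the roots of [P] at [z0]. On any
    other circle this polynomial is bounded away from zero, so for [z] near [z0] the polynomial at
    [z] has no root there and [f z] avoids the circle. *)
Lemma generic_side (P : {poly {poly C}}) (r : C) : P.[z0%:P] != 0 ->
  (forall z, D z -> P.[z%:P].[f z] = 0) ->
  exists s : seq R, forall t, 0 <= t -> t \notin s ->
    near_point (fun z => normc (f z - r) ^+ 2 < t) \/ near_point (fun z => t < normc (f z - r) ^+ 2).
Proof.
move=> Q0 Pf; have [rs Qrs] := closed_field_poly_normal P.[z0%:P].
exists [seq normc (x - r) ^+ 2 | x <- rs] => t t0 ts.
apply: near_point_side.
  move=> z1 z2 Dz1 Dz2; have [L HL] := f_lip Dz1 Dz2.
  pose B := normc (f z1 - r) + `|L|.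
  exists (L * (B + B)) => a b a01 b01.
  set u := f _ - r; set w := f _ - r.
  have uw : normc (u - w) <= L * `|a - b|.
    have -> : u - w = f (z1 + a%:C * (z2 - z1)) - f (z1 + b%:C * (z2 - z1)).
      by rewrite /u /w; ring.
    exact: HL.
  have bnd c : 0 <= c <= 1 -> normc (f (z1 + c%:C * (z2 - z1)) - r) <= B.
    move=> c01; have := HL c 0 c01 (_ : 0 <= 0 <= 1); rewrite lexx ler01 => /(_ isT).
    rewrite mul0r addr0 subr0 => h.
    set x := f _ in h *; have -> : x - r = (x - f z1) + (f z1 - r) by ring.
    rewrite (le_trans (le_normcD _ _)) // addrC lerD2l (le_trans h) //.
    case/andP: c01 => c0 c1; rewrite (ger0_norm c0) (le_trans (ler_norm _)) //.
    by rewrite normrM (ger0_norm c0) ler_piMr.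
  rewrite subr_sqr normrM.
  rewrite mulrAC; apply: ler_pM => //; first exact: le_trans (ler_normcB _ _) uw.
  by rewrite ger0_norm ?addr_ge0 ?normc_ge0 // lerD // bnd.
have [||c c0 Hc] := @circle_lower_bound _ r (Num.sqrt t) Q0; first exact: sqrtr_ge0.
  move=> x Qx; apply: contraNneq ts => xr; apply/mapP; exists x; last first.
    by rewrite xr sqr_sqrtr.
  by move: Qx; rewrite Qrs rootZ ?lead_coef_eq0 // root_prod_XsubC.
have [K [n [K0 HK]]] := poly2_lipschitz P z0.
(* On the circle [1 + normc r + Num.sqrt t] bounds [1 + normc w]; the final summand 1 makes [M]
   positive. *)
pose M := K * (1 + normc r + Num.sqrt t) ^+ n + 1.
have M0 : 0 < M.
  by rewrite ltr_wpDl // mulr_ge0 // exprn_ge0 // !addr_ge0 ?normc_ge0 ?sqrtr_ge0.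
exists (Num.min 1 (c / M)); first by rewrite lt_min ltr01 divr_gt0.
move=> z Dz; rewrite lt_min => /andP[/ltW z1]; rewrite ltr_pdivlMr // => zM.
apply/eqP => /(congr1 Num.sqrt); rewrite sqrtr_sqr ger0_norm ?normc_ge0 // => fzt.
have := HK z (f z) z1; rewrite (Pf _ Dz) sub0r normcN leNgt => /negP; apply.
apply: lt_le_trans (Hc _ fzt); apply: le_lt_trans zM.
rewrite mulrAC mulrC ler_wpM2l ?normc_ge0 // /M.
apply: le_trans (_ : K * (1 + normc r + Num.sqrt t) ^+ n <= _); last by rewrite lerDl.
rewrite ler_wpM2l // lerXn2r ?nnegrE ?addr_ge0 ?normc_ge0 ?sqrtr_ge0 //.
rewrite -addrA lerD2l -fzt (le_trans _ (le_normcD _ _)) //.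
by rewrite [r + _]addrC subrK.
Qed.

Theorem limit_dichotomy (P : {poly {poly C}}) : P != 0 ->
  (forall z, D z -> P.[z%:P].[f z] = 0) ->
  (exists l : C, forall e : R, 0 < e -> near_point (fun z => normc (f z - l) < e)) \/
  (forall M : R, near_point (fun z => M < normc (f z))).
Proof.
move=> Pn0 Pf; have [P' P'0 P'P] := poly2_normalize z0 Pn0.
have P'f z : D z -> P'.[z%:P].[f z] = 0.
  by move=> Dz; apply: P'P (Pf _ Dz); apply: contraPneq Dz => ->.
have side r := generic_side r P'0 P'f.
have [[B B0 HB]|unb] := pselect (exists2 B : R, 0 <= B & near_point (fun z => normc (f z) < B)).
  left.
  have lim r : exists l : R, forall e : R, 0 < e ->
      near_point (fun z => `|normc (f z - r) ^+ 2 - l| < e).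
    have [s Hs] := side r.
    apply: threshold_limit Hs _; first by move=> z; rewrite sqr_ge0.
    exists ((B + normc r) ^+ 2); first by rewrite sqr_ge0.
    apply: near_point_sub HB => z _ zB.
    rewrite ltrXn2r ?nnegrE ?normc_ge0 ?addr_ge0 ?normc_ge0 //.
    by rewrite (le_lt_trans (le_normcD _ _)) // normcN ltrD2r.
  have [l0 H0] := lim 0; have [l1 H1] := lim 1; have [l2 H2] := lim 'i.
  (* A point is determined by its squared distances to 0, 1 and ['i], since
     [|w|^2 - |w - 1|^2 + 1 = 2 Re w] and [|w|^2 - |w - 'i|^2 + 1 = 2 Im w]. Squared distances make
     these formulas linear. *)
  exists (((l0 + 1 - l1) / 2) +i* ((l0 + 1 - l2) / 2)) => e e0.
  have e4 : 0 < e / 4 by rewrite divr_gt0.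
  apply: near_point_sub (near_point_and (H0 _ e4) (near_point_and (H1 _ e4) (H2 _ e4))) => z _ [h0 [h1 h2]].
  apply: le_lt_trans (normc_le _) _.
  move: h0 h1 h2; rewrite !sqr_normcE; case: (f z) => x y /=.
  rewrite !ltr_norml !subr0 => /andP[h0 h0'] /andP[h1 h1'] /andP[h2 h2'].
  have hx : `|x - (l0 + 1 - l1) / 2| <= e / 4.
    by rewrite ler_norml; apply/andP; split; nra.
  have hy : `|y - (l0 + 1 - l2) / 2| <= e / 4.
    by rewrite ler_norml; apply/andP; split; nra.
  lra.
right => M; have [s Hs] := side 0.
have [x /andP[xM _] xs] := @avoid_seq s (M ^+ 2) (M ^+ 2 + 1) ltac:(lra).
have x0 : 0 <= x by apply: le_trans (sqr_ge0 M) (ltW xM).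
case: (Hs x x0 xs) => Hx.
  case: unb; exists (Num.sqrt x); first exact: sqrtr_ge0.
  apply: near_point_sub Hx => z _; rewrite subr0 => h.
  by rewrite -(@ltr_pXn2r _ 2) ?nnegrE ?normc_ge0 ?sqrtr_ge0 // sqr_sqrtr.
apply: near_point_sub Hx => z _; rewrite subr0 => h.
rewrite (le_lt_trans (ler_norm M)) // -(@ltr_pXn2r _ 2) ?nnegrE ?normc_ge0 //.
by rewrite real_normK ?num_real // (lt_trans xM).
Qed.

End Dichotomy.

(** * Operations on annihilating polynomials *)

Section Annihilators.
Context {R : realType}.
Local Notation C := R[i].
Implicit Types P Q : {poly {poly C}}.

(** [sub_annihilant] is a resultant and requires positive degree in the unknown. A polynomial that
    does not depend on the unknown vanishes at [s] for every value of it, so it serves as [Q]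
    itself. *)
Lemma annihilator_sub P1 P2 : P1 != 0 -> P2 != 0 ->
  exists2 Q, Q != 0 & forall s w1 w2,
    P1.[s%:P].[w1] = 0 -> P2.[s%:P].[w2] = 0 -> Q.[s%:P].[w1 - w2] = 0.
Proof.
move=> P10 P20.
have const P : (size (swapXY P) <= 1)%N -> forall s w w', P.[s%:P].[w] = P.[s%:P].[w'].
  move=> /size1_polyC PE s w w'.
  by rewrite -(horner2_swapXY P w s) -(horner2_swapXY P w' s) PE !hornerC.
have [p1|p1] := leqP (size (swapXY P1)) 1.
  by exists P1 => // s w1 w2 h _; rewrite (const _ p1 _ _ w1).
have [p2|p2] := leqP (size (swapXY P2)) 1.
  by exists P2 => // s w1 w2 _ h; rewrite (const _ p2 _ _ w2).
have [uv _ H] := sub_annihilant_in_ideal p1 p2.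
have : sub_annihilant (swapXY P1) (swapXY P2) != 0.
  by rewrite sub_annihilant_neq0 ?swapXY_eq0.
move: (sub_annihilant _ _) H => Q H Q0.
exists (swapXY Q); first by rewrite swapXY_eq0.
move=> s w1 w2 h1 h2; rewrite horner2_swapXY.
have := congr1 (fun p => p.[s]) (H w2%:P (w1 - w2)%:P).
rewrite hornerD !hornerM -polyCD [w2 + _]addrC subrK !horner2_swapXY h1 h2.
by rewrite !mulr0 addr0.
Qed.

Definition conj_poly2 P : {poly {poly C}} := map_poly (map_poly (@conjc R)) P.

Lemma conj_poly2_eq0 P : (conj_poly2 P == 0) = (P == 0).
Proof.
have [->|P0] := eqVneq P 0; first by rewrite /conj_poly2 map_poly0 eqxx.
by rewrite map_poly_eq0_id0 ?(negPf P0) // map_poly_eq0 lead_coef_eq0.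
Qed.

Lemma conj_poly2_horner P z w :
  (conj_poly2 P).[(conjc z)%:P].[conjc w] = conjc P.[z%:P].[w].
Proof.
have -> : (conjc z)%:P = map_poly (@conjc R) z%:P by rewrite map_polyC.
by rewrite horner_map horner_map.
Qed.

Definition line_poly2 P (a b : C) : {poly {poly C}} :=
  P \Po (a%:P%:P + b%:P *: 'X).

Lemma line_poly2_neq0 P a b : b != 0 -> P != 0 -> line_poly2 P a b != 0.
Proof.
move=> b0 P0; rewrite /line_poly2 comp_poly2_eq0 //.
rewrite addrC size_polyDl size_scale ?polyC_eq0 ?size_polyX //.
by rewrite size_polyC; case: (_ == _).
Qed.

Lemma line_poly2_horner P a b s w :
  (line_poly2 P a b).[s%:P].[w] = P.[(a + b * s)%:P].[w].
Proof.
by rewrite /line_poly2 horner_comp hornerD hornerC hornerZ hornerX -polyCM -polyCD.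
Qed.

Definition pole_poly2 (t c : C) : {poly {poly C}} :=
  ('X)%:P * 'X - (t *: 'X - c%:P)%:P.

Lemma pole_poly2_neq0 t c : pole_poly2 t c != 0.
Proof.
apply/eqP => /(congr1 (fun p : {poly {poly C}} => p`_1)).
by rewrite /pole_poly2 coefB coefCM coefX coefC mulr1 subr0 coef0; apply/eqP; rewrite polyX_eq0.
Qed.

Lemma pole_poly2_horner t c z : z != t -> (pole_poly2 t c).[z%:P].[c / (t - z)] = 0.
Proof.
move=> zt; rewrite /pole_poly2 !hornerE /=; field.
by rewrite subr_eq0 eq_sym.
Qed.

Lemma poly_away_from_zero (p : {poly C}) : p != 0 ->
  exists c : R, exists2 r : R, 0 < c & forall w, r <= normc w -> c <= normc p.[w].
Proof.
move=> p0; have [rs prs] := closed_field_poly_normal p.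
have [r Hr] : exists r : R, forall x, x \in rs -> normc x <= r.
  elim: rs {prs} => [|x rs [r IH]]; first by exists 0.
  exists (Num.max (normc x) r) => y; rewrite inE => /orP[/eqP ->|/IH h].
    by rewrite le_max lexx.
  by rewrite le_max h orbT.
exists (normc (lead_coef p)), (r + 1); first by rewrite normc_gt0 // lead_coef_eq0.
move=> w wr; rewrite [in leRHS]prs hornerZ normcM ler_peMr ?normc_ge0 //.
rewrite horner_prod normc_prod big_seq; apply: (big_ind (fun u => 1 <= u)) => [|x y|x xrs]; first exact: lexx.
  exact: mulr_ege1.
rewrite hornerXsubC; apply: le_trans (ler_normcB w x).
apply: le_trans (ler_norm _); have := Hr _ xrs; lra.
Qed.

End Annihilators.

Section RightLimits.
Context {R : realType}.

Lemma near_right0P (A : R -> Prop) :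
  (\forall x \near 0^'+, A x) <-> exists2 e : R, 0 < e & forall x, 0 < x < e -> A x.
Proof.
split=> [|[e e0 eA]].
  rewrite /prop_near1 /at_right /within /= => -[e /= e0 eA].
  exists e => // x /andP[x0 xe]; apply: eA => //=.
  by rewrite sub0r normrN gtr0_norm.
near=> x; apply: eA; apply/andP; split; near: x.
  exact: nbhs_right_gt.
exact: nbhs_right_lt.
Unshelve. all: by end_near. Qed.

End RightLimits.

(** * Boundary limits in the upper half-plane *)

Section UpperHalfPlane.
Context {R : realType}.
Local Notation C := R[i].
Local Notation H := (@upper_half_plane R).

Definition halfplane_lipschitz (f : C -> C) := forall c : R, 0 < c ->
  exists L : R, forall z w, c <= complex.Im z -> c <= complex.Im w ->
    normc (f z - f w) <= L * normc (z - w).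

Lemma Im_segment (z1 z2 : C) (s : R) :
  complex.Im (z1 + s%:C * (z2 - z1)) =
  (1 - s) * complex.Im z1 + s * complex.Im z2.
Proof. by case: z1 z2 => a b [c d] /=; ring. Qed.

Lemma upper_half_plane_convex : segment_convex H.
Proof.
move=> z1 z2 s; rewrite /upper_half_plane /= => h1 h2 /andP[s0 s1].
rewrite Im_segment; have [->|sn0] := eqVneq s 0; first by rewrite subr0 mul1r mul0r addr0.
by rewrite ltr_wpDl ?mulr_ge0 ?subr_ge0 ?(ltW h1) // mulr_gt0 // lt_neqAle eq_sym sn0 s0.
Qed.

Lemma halfplane_lipschitz_segment f : halfplane_lipschitz f -> segment_lipschitz H f.
Proof.
move=> fL z1 z2; rewrite /upper_half_plane /= => h1 h2.
set c := Num.min (complex.Im z1) (complex.Im z2).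
have c0 : 0 < c by rewrite lt_min h1.
have [L HL] := fL _ c0.
have cs (s : R) : 0 <= s <= 1 -> c <= complex.Im (z1 + s%:C * (z2 - z1)).
  move=> /andP[s0 s1]; rewrite Im_segment.
  have : (1 - s) * c <= (1 - s) * complex.Im z1.
    by rewrite ler_wpM2l ?subr_ge0 // /c ge_min lexx.
  have : s * c <= s * complex.Im z2 by rewrite ler_wpM2l // /c ge_min lexx orbT.
  lra.
exists (L * normc (z2 - z1)) => s t s01 t01.
apply: le_trans (HL _ _ (cs _ s01) (cs _ t01)) _.
have -> : z1 + s%:C * (z2 - z1) - (z1 + t%:C * (z2 - z1)) = (s - t)%:C * (z2 - z1).
  by rewrite rmorphB; ring.
by rewrite normcM normcR -mulrA [normc _ * _]mulrC.
Qed.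

Lemma not_upper_real (t : R) : ~ H t%:C.
Proof. by rewrite /upper_half_plane /= ltxx. Qed.

Lemma near_point_vertical (t : R) (A : C -> Prop) : near_point H t%:C A ->
  \forall eta \near 0^'+, A (t +i* eta).
Proof.
move=> [e e0 eA]; apply/near_right0P; exists e => // x /andP[x0 xe].
apply: eA; first by rewrite /upper_half_plane.
have -> : t +i* x - t%:C = 0 +i* x by apply/eqP; rewrite eq_complex /= subrr subr0 !eqxx.
by rewrite /= expr0n add0r sqrtr_sqr gtr0_norm.
Qed.

Definition algebraic_on (D : set C) (f : C -> C) :=
  exists2 P : {poly {poly C}}, P != 0 & forall z, D z -> P.[z%:P].[f z] = 0.

Lemma boundary_dichotomy f (t : R) : algebraic_on H f -> halfplane_lipschitz f ->
  (exists l : C, forall e : R, 0 < e -> near_point H t%:C (fun z => normc (f z - l) < e)) \/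
  (forall M : R, near_point H t%:C (fun z => M < normc (f z))).
Proof.
move=> [P P0 Pf] fL; apply: (@limit_dichotomy _ _ _ _ _ _ _ P) => //.
- exact: halfplane_lipschitz_segment.
- exact: upper_half_plane_convex.
- exact: not_upper_real.
Qed.

(** A real half-line placed in the complex plane, so that [limit_dichotomy] applies to functions of
    one real variable. *)
Definition positive_axis : set C := [set z | 0 < complex.Re z /\ complex.Im z = 0].

Lemma positive_axis_convex : segment_convex positive_axis.
Proof.
move=> [a b] [c d] s; rewrite /positive_axis /= => -[a0 ->] [c0 ->] /andP[s0 s1].
split; last by ring.
have [->|sn0] := eqVneq s 0; first by rewrite !mul0r subr0 addr0.
have s0' : 0 < s by rewrite lt_neqAle eq_sym sn0.
have : 0 < s * c by rewrite mulr_gt0.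
have : 0 <= (1 - s) * a by rewrite mulr_ge0 ?subr_ge0 // ltW.
lra.
Qed.

Lemma subcJE (z : C) : z - conjc z = 0 +i* (2 * complex.Im z).
Proof. by case: z => a b /=; apply/eqP; rewrite eq_complex /=; apply/andP; split; apply/eqP; ring. Qed.

Lemma normc_subJ (z : C) : normc (z - conjc z) = 2 * `|complex.Im z|.
Proof. by rewrite subcJE /= expr0n add0r sqrtr_sqr normrM ger0_norm. Qed.

(** [Im f] is not algebraic in [z], but it is so along a vertical line: there the parameter [s] is
    real, hence equal to its conjugate, and the conjugate polynomial annihilates the conjugate of
    [f]. The difference [f - conjc f = 2i Im f] is then annihilated as well. *)
Lemma Im_vertical_dichotomy f (t : R) : algebraic_on H f -> halfplane_lipschitz f ->
  (exists y : R, forall e : R, 0 < e ->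
     \forall eta \near 0^'+, `|complex.Im (f (t +i* eta)) - y| < e) \/
  (forall M : R, \forall eta \near 0^'+, M < `|complex.Im (f (t +i* eta))|).
Proof.
move=> [P P0 Pf] fL.
pose g (s : C) := f (t +i* complex.Re s).
pose k s := g s - conjc (g s).
pose P1 := line_poly2 P t%:C 'i.
have i0 : 'i != 0 :> C by rewrite eq_complex /= oner_eq0 andbF.
have P10 : P1 != 0 by rewrite line_poly2_neq0.
have P20 : conj_poly2 P1 != 0 by rewrite conj_poly2_eq0.
have [Q Q0 HQ] := annihilator_sub P10 P20.
have toaxis (A : C -> Prop) : near_point positive_axis 0 A -> \forall eta \near 0^'+, A eta%:C.
  move=> [e e0 eA]; apply/near_right0P; exists e => // x /andP[x0 xe]; apply: eA.
    by rewrite /positive_axis.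
  by rewrite subr0 normcR gtr0_norm.
have Qk s : positive_axis s -> Q.[s%:P].[k s] = 0.
  case: s => x y [/= x0 ->]; set s := _ +i* _.
  have h1 : P1.[s%:P].[g s] = 0.
    rewrite /P1 line_poly2_horner.
    have -> : t%:C + 'i * s = t +i* x.
      by apply/eqP; rewrite eq_complex /s /=; apply/andP; split; apply/eqP; ring.
    exact: Pf.
  apply: (HQ _ _ _ h1).
  have sJ : conjc s = s by rewrite /s /= oppr0.
  by rewrite -{1}sJ conj_poly2_horner h1 conjc0.
have kL : segment_lipschitz positive_axis k.
  move=> [x1 y1] [x2 y2]; rewrite /positive_axis /= => -[x10 ->] [x20 ->].
  have [||L HL] := halfplane_lipschitz_segment fL (_ : H (t +i* x1)) (_ : H (t +i* x2)).
  - by [].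
  - by [].
  exists (2 * L) => a b a01 b01.
  have gE (c : R) : g ((x1 +i* 0) + c%:C * (x2 +i* 0 - x1 +i* 0)) =
      f (t +i* x1 + c%:C * (t +i* x2 - t +i* x1)).
    rewrite /g; congr f; apply/eqP; rewrite eq_complex /=.
    by apply/andP; split; apply/eqP; ring.
  rewrite /k !gE; set u := f _; set v := f _.
  have -> : u - conjc u - (v - conjc v) = (u - v) - conjc (u - v).
    by rewrite rmorphB; ring.
  rewrite normc_subJ -mulrA ler_wpM2l //.
  exact: le_trans (Im_le_normc _) (HL _ _ a01 b01).
have [] := @limit_dichotomy _ positive_axis 0 k kL positive_axis_convex _ Q Q0 Qk.
- by rewrite /positive_axis /= ltxx => -[].
- move=> [l Hl]; left; exists (complex.Im l / 2) => e e0.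
  have /toaxis := Hl _ e0; apply: filterS => x.
  rewrite /k /g /= subcJE => h; have := le_lt_trans (Im_le_normc _) h.
  case: (l) => l1 l2 /=; move: (complex.Im _) => y.
  rewrite !ltr_norml; lra.
- move=> Hk; right => M; have /toaxis := Hk (2 * M); apply: filterS => x.
  by rewrite /k normc_subJ /g /= ltr_pM2l.
Qed.

End UpperHalfPlane.

(** * Singularities *)

Section Singularities.
Context {R : realType}.
Local Notation C := R[i].
Local Notation H := (@upper_half_plane R).

(** The radii in the topology of [R[i]^o] are complex numbers; the positive ones are the positive
    reals, which allows the passage to [normc]. *)
Lemma cvg_normcP (T : Type) (F : set_system T) (FF : Filter F) (g : T -> R[i]^o)
    (l : R[i]^o) :
  g x @[x --> F] --> l <-> forall e : R, 0 < e -> \forall x \near F, normc (g x - l) < e.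
Proof.
split=> [/cvgrPdist_lt gl e e0|gl].
  have e0' : 0 < e%:C :> C by rewrite ltcR.
  apply: (@filterS _ F FF _ _ _ (gl _ e0')) => x; rewrite ltcE /= => /andP[_].
  by rewrite normcB; case: (l - g x).
apply/cvgrPdist_lt => -[e e']; rewrite ltcE /= => /andP[/eqP -> e0].
apply: (@filterS _ F FF _ _ _ (gl _ e0)) => x; rewrite normcB ltcE; case: (l - g x) => a b /=.
by rewrite eqxx.
Qed.

Lemma poly_locally_bounded (p : {poly C}) (t : C) : exists B : R, 0 <= B /\
  forall z, normc (z - t) <= 1 -> normc p.[z] <= B.
Proof.
have [K [n [K0 HK]]] := poly_growth p.
have t0 := normc_ge0 t.
exists (K * (2 + normc t) ^+ n); split; first by rewrite mulr_ge0 ?exprn_ge0 ?addr_ge0.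
move=> z zt; apply: le_trans (HK z) _; rewrite ler_wpM2l //.
rewrite lerXn2r ?nnegrE ?addr_ge0 ?normc_ge0 //.
have := le_normcD (z - t) t; rewrite subrK; lra.
Qed.

Lemma poly_locally_lipschitz (p : {poly C}) (t : C) : exists B : R, 0 <= B /\
  forall z, normc (z - t) <= 1 -> normc (p.[z] - p.[t]) <= B * normc (z - t).
Proof.
have /factor_theorem [q pq] : root (p - p.[t]%:P) t.
  by rewrite /root hornerD hornerN hornerC subrr.
have [B [B0 HB]] := poly_locally_bounded q t; exists B; split => // z zt.
have -> : p.[z] - p.[t] = q.[z] * (z - t).
  by have := congr1 (fun p => p.[z]) pq; rewrite !hornerE.
by rewrite normcM ler_wpM2r ?normc_ge0 // HB.
Qed.

(* In the next two lemmas the outer variable is the unknown. *)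
Lemma poly2_degree_bound (Q : {poly {poly C}}) (t : C) : exists B : R, 0 <= B /\
  forall z w, normc (z - t) <= 1 -> 1 <= normc w ->
    normc Q.[w%:P].[z] <= B * normc w ^+ (size Q).-1.
Proof.
elim/poly_ind: Q => [|Q c [B [B0 HB]]].
  by exists 0; split => // z w _ _; rewrite !horner0 normc0 mul0r.
have [K [K0 HK]] := poly_locally_bounded c t.
exists (B + K); split; first by rewrite addr_ge0.
move=> z w zt w1; rewrite hornerMXaddC hornerD size_MXaddC.
have [->|Q0] := eqVneq Q 0.
  rewrite horner0 mul0r horner0 add0r /=; case: ifP => [/eqP ->|_].
    by rewrite horner0 normc0 mulr_ge0 ?addr_ge0 ?exprn_ge0 ?normc_ge0.
  by rewrite size_poly0 expr0 mulr1 (le_trans (HK _ zt)) // lerDr.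
rewrite /= (le_trans (le_normcD _ _)) // mulrDl; apply: lerD; last first.
  by rewrite (le_trans (HK _ zt)) // ler_peMr // exprn_ege1.
rewrite hornerM hornerC normcM (polySpred Q0) exprSr mulrA.
by apply: ler_wpM2r; rewrite ?normc_ge0 // HB.
Qed.

Lemma lead_coef_bound (Q : {poly {poly C}}) (t : C) : exists B : R, 0 <= B /\
  forall z w, normc (z - t) <= 1 -> 1 <= normc w -> Q.[w%:P].[z] = 0 ->
    normc (lead_coef Q).[z] * normc w <= B.
Proof.
have [->|Q0] := eqVneq Q 0.
  by exists 0; split => // z w _ _ _; rewrite lead_coef0 horner0 normc0 mul0r.
(* At a root of [Q] the leading term is the opposite of [Q'], whose degree is smaller; this gains
   one power of [normc w]. *)
pose Q' := Q - lead_coef Q *: 'X^((size Q).-1).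
have sQ' : (size Q' <= (size Q).-1)%N.
  apply/leq_sizeP => i; rewrite leq_eqVlt => /orP[/eqP <-|lti].
    by rewrite coefB coefZ coefXn eqxx mulr1 lead_coefE subrr.
  rewrite coefB coefZ coefXn gtn_eqF // mulr0 subr0 nth_default //.
  by rewrite (polySpred Q0).
have [B [B0 HB]] := poly2_degree_bound Q' t; exists B; split => // z w zt w1.
have w0 : 0 < normc w by apply: lt_le_trans w1.
have -> : Q = Q' + lead_coef Q *: 'X^((size Q).-1) by rewrite subrK.
rewrite -/Q' hornerD hornerZ hornerXn hornerD hornerM -polyC_exp hornerC => /eqP.
rewrite addrC addr_eq0 => /eqP /(congr1 (@normc _)).
rewrite normcN normcM normcX => E.
rewrite subrK; have [Q'0|Q'0] := eqVneq Q' 0.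
  move: E; rewrite Q'0 !horner0 normc0 => /eqP; rewrite mulf_eq0 expf_eq0 (gt_eqF w0).
  by rewrite andbF orbF => /eqP ->; rewrite mul0r.
have n0 : (0 < (size Q).-1)%N by apply: leq_trans sQ'; rewrite size_poly_gt0.
have := HB z w zt w1; rewrite -E -(prednK n0) exprS mulrA => h.
rewrite -(@ler_pM2r _ (normc w ^+ (size Q).-1.-1)) ?exprn_gt0 //.
apply: le_trans h _; rewrite ler_wpM2l // ler_weXn2l //.
by rewrite -ltnS prednK ?size_poly_gt0 // prednK.
Qed.

Variable f : C -> C.

Lemma sing_setP t : sing_set f t <->
  forall M : R, \forall eta \near 0^'+, M < normc (f (t +i* eta)).
Proof. by rewrite /sing_set /=; split=> [/cvgryPgt//|h]; apply/cvgryPgt. Qed.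

Lemma im_sing_setP t : im_sing_set f t <->
  forall M : R, \forall eta \near 0^'+, M < complex.Im (f (t +i* eta)).
Proof. by rewrite /im_sing_set /=; split=> [/cvgryPgt//|h]; apply/cvgryPgt. Qed.

Hypothesis f_alg : algebraic_on H f.
Hypothesis f_lip : halfplane_lipschitz f.

Lemma nonsingular_limit t : ~ sing_set f t ->
  exists l : C, forall e : R, 0 < e -> near_point H t%:C (fun z => normc (f z - l) < e).
Proof.
move=> nt; case: (boundary_dichotomy t f_alg f_lip) => // h.
by case: nt; apply/sing_setP => M; apply: (near_point_vertical (h M)).
Qed.

Lemma nonsingular_boundary_value t : ~ sing_set f t -> has_boundary_value f t.
Proof.
move=> /nonsingular_limit [l Hl]; exists l; apply/cvg_normcP => e e0.
exact: (near_point_vertical (Hl _ e0)).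
Qed.

Lemma sing_set_finite : finite_set (sing_set f).
Proof.
have [P P0 Pf] := f_alg.
pose S := swapXY P.
have S0 : lead_coef S != 0 by rewrite lead_coef_eq0 swapXY_eq0.
have [rs Hrs] := closed_field_poly_normal (lead_coef S).
apply: (@sub_finite_set _ _ (@complex.Re R @` [set` rs])); last exact: finite_image.
move=> t /sing_setP st; exists t%:C => //=.
rewrite -root_prod_XsubC -(@rootZ _ _ (lead_coef (lead_coef S))) //; last first.
  by rewrite lead_coef_eq0.
(* Near [t] the product of this leading coefficient with [f] stays bounded whereas [f] does not, so
   the coefficient vanishes at [t]. *)
rewrite -Hrs; apply/rootP/eq0_normc/eqP; rewrite eq_le normc_ge0 andbT.
apply/ler_addgt0Pl => e e0; rewrite addr0.
have [B [B0 HB]] := lead_coef_bound S t%:C.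
have [K [K0 HK]] := poly_locally_lipschitz (lead_coef S) t%:C.
near (0 : R)^'+ => eta.
have eta0 : 0 < eta by near: eta; exact: nbhs_right_gt.
have zt : normc ((t +i* eta) - t%:C) = eta.
  have -> : t +i* eta - t%:C = 0 +i* eta.
    by apply/eqP; rewrite eq_complex /= subrr subr0 !eqxx.
  by rewrite /= expr0n add0r sqrtr_sqr gtr0_norm.
have eta1 : eta < 1 by near: eta; exact: nbhs_right_lt.
have etae : eta < e / 2 / (K + 1).
  by near: eta; apply: nbhs_right_lt; rewrite !divr_gt0 // ltr_wpDl.
have w1 : 1 < normc (f (t +i* eta)) by near: eta; exact: st.
have wB : (B + 1) / (e / 2) < normc (f (t +i* eta)) by near: eta; exact: st.
have h1 := HK (t +i* eta); rewrite zt in h1; have {}h1 := h1 (ltW eta1).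
have h2 := HB (t +i* eta) (f (t +i* eta)); rewrite zt in h2.
have {}h2 := h2 (ltW eta1) (ltW w1).
rewrite horner2_swapXY Pf // in h2; have {}h2 := h2 erefl.
move: h1 h2; set a := (lead_coef S).[_]; set b := (lead_coef S).[_] => h1 h2.
have := le_normcD (b - a) a; rewrite subrK normcB.
move: etae wB; rewrite ltr_pdivlMr ?ltr_pdivrMr ?divr_gt0 ?ltr_wpDl // => etae wB.
have a0 := normc_ge0 a; move: h2 wB; move: (normc (f _)) => w h2 wB.
have : normc a <= e / 2.
  rewrite leNgt; apply/negP => ae.
  have : w * (e / 2) <= w * normc a by rewrite ler_wpM2l ?(ltW ae) //; nra.
  nra.
nra.
Unshelve. all: by end_near. Qed.

End Singularities.

Section ImaginarySingularities.
Context {R : realType}.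
Local Notation C := R[i].
Local Notation H := (@upper_half_plane R).

(** Along [k = (n + 1)(p + 1)] the left side is at least [c (p + 1)^(n + 1)] and the right side at
    most [K d^n (p + 1)^n], so [c (p + 1)] would be bounded in [p]. *)
Lemma exponential_beats_power (c K a b : R) (n : nat) : 0 < c -> 0 <= K -> 0 <= a -> 0 <= b ->
  ~ forall k : nat, c * 2 ^+ k <= K * (a + b * k%:R) ^+ n.
Proof.
move=> c0 K0 a0 b0 Hk.
pose d := a + b * n.+1%:R.
have d0 : 0 <= d by rewrite addr_ge0 // mulr_ge0.
have Hp (p : nat) : c * p.+1%:R <= K * d ^+ n.
  have p0 : 0 < p.+1%:R :> R by [].
  rewrite -(@ler_pM2r _ (p.+1%:R ^+ n)) ?exprn_gt0 // -mulrA -exprS -mulrA -exprMn.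
  apply: le_trans (_ : c * 2 ^+ (n.+1 * p.+1) <= _).
    rewrite ler_wpM2l ?(ltW c0) // mulnC exprM lerXn2r ?nnegrE ?exprn_ge0 //.
    by rewrite -natrX ler_nat ltnW // ltn_expl.
  apply: le_trans (Hk _) _; rewrite ler_wpM2l // lerXn2r ?nnegrE ?addr_ge0 ?mulr_ge0 //.
  rewrite /d mulrDl natrM mulrA lerD2r ler_peMr //.
  by rewrite ler1n.
have [p Hp'] : exists p : nat, K * d ^+ n / c < p.+1%:R.
  exists (Num.bound (K * d ^+ n / c)).
  apply: lt_le_trans (_ : (Num.bound (K * d ^+ n / c))%:R <= _); last by rewrite ler_nat.
  by rewrite archi_boundP // divr_ge0 ?mulr_ge0 ?exprn_ge0 // ltW.
move: Hp'; rewrite ltr_pdivrMr // [_%:R * c]mulrC => /lt_le_trans /(_ (Hp p)).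
by rewrite ltxx.
Qed.

Variable f : C -> C.
Hypothesis f_alg : algebraic_on H f.
Hypothesis f_lip : halfplane_lipschitz f.
Hypothesis f_im : forall z, H z -> 0 <= complex.Im (f z).
Hypothesis f_half : forall t eta : R, 0 < eta ->
  `|complex.Re (f (t +i* (eta / 2))) - complex.Re (f (t +i* eta))|
    <= complex.Im (f (t +i* eta)).

(* By [f_half] a bounded imaginary part lets the modulus grow at most
   logarithmically in [eta], whereas an algebraic function which blows up does so
   at least like a power. *)
Lemma sing_set_im : sing_set f = im_sing_set f.
Proof.
apply/seteqP; split=> t; last first.
  move=> /im_sing_setP h; apply/sing_setP => M; apply: filterS (h M) => eta /lt_le_trans.
  by apply; rewrite (le_trans (ler_norm _)) // Im_le_normc.
move=> /sing_setP st; apply/im_sing_setP.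
have Hpos (eta : R) : 0 < eta -> H (t +i* eta) by [].
case: (Im_vertical_dichotomy t f_alg f_lip) => [[y Hy]|h]; last first.
  move=> M; near=> eta; have eta0 : 0 < eta by near: eta; exact: nbhs_right_gt.
  by rewrite -[ltRHS]ger0_norm ?f_im //; near: eta; exact: h.
exfalso.
have [P P0 Pf] := f_alg.
have [P' P'0 P'P] := poly2_normalize t%:C P0.
have P'f z : H z -> P'.[z%:P].[f z] = 0.
  by move=> Hz; apply: P'P (Pf _ Hz); apply: contraPneq Hz => ->; exact: not_upper_real.
have [c [r c0 Hr]] := poly_away_from_zero P'0.
have [K [n [K0 HK]]] := poly2_lipschitz P' t%:C.
have [d1 d10 Hd1] := (near_right0P _).1 (Hy 1 ltr01).
have [d2 d20 Hd2] := (near_right0P _).1 (st r).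
pose e := Num.min d1 (Num.min d2 1) / 2.
have m0 : 0 < Num.min d1 (Num.min d2 1) by rewrite !lt_min d10 d20 ltr01.
have e0 : 0 < e by rewrite divr_gt0.
have em : e < Num.min d1 (Num.min d2 1) by rewrite /e; lra.
move: (em); rewrite !lt_min => /andP[ed1 /andP[ed2 e1]].
(* At dyadic heights each halving moves the real part by at most [Y], whence a bound linear in
   [k]. *)
pose x k := e / 2 ^+ k.
have xS k : x k.+1 = x k / 2 by rewrite /x exprS invfM; ring.
have x0 k : 0 < x k by rewrite /x divr_gt0 // exprn_gt0.
have xe k : x k <= e.
  by rewrite /x ler_pdivrMr ?exprn_gt0 // ler_peMr ?(ltW e0) // exprn_ege1 // ler1n.
pose Y := `|y| + 1.
have Y0 : 0 <= Y by rewrite addr_ge0.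
have imY k : `|complex.Im (f (t +i* x k))| <= Y.
  have := Hd1 (x k); rewrite x0 (le_lt_trans (xe k) ed1) => /(_ isT).
  move: (complex.Im _) => u h; rewrite -[u](subrK y) addrC.
  by rewrite (le_trans (ler_normD _ _)) // lerD2l ltW.
pose A := `|complex.Re (f (t +i* x 0))|.
have reY k : `|complex.Re (f (t +i* x k))| <= A + k%:R * Y.
  elim: k => [|k IH]; first by rewrite mul0r addr0.
  have := f_half t (x0 k); rewrite -xS => h.
  have := le_trans h (le_trans (ler_norm _) (imY k)).
  move: (complex.Re (f (t +i* x k.+1))) (complex.Re (f (t +i* x k))) IH => u v IH uv.
  rewrite -[u](subrK v) (le_trans (ler_normD _ _)) // -natr1 mulrDl mul1r.
  move: IH uv; rewrite addrA; lra.
(* For large [f] the normalised polynomial at [t] is at least [c], and it is at most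
   [K * x k * (1 + |f|)^n] because the polynomial at [t +i* x k] vanishes. Inserting the linear
   bound on [|f|] contradicts [x k = e / 2^k]. *)
apply: (@exponential_beats_power c (K * e) (1 + A + Y) Y n) => //.
- by rewrite mulr_ge0 // ltW.
- by rewrite !addr_ge0 ?normr_ge0.
move=> k; rewrite -ler_pdivlMr ?exprn_gt0 //.
have zt : normc (t +i* x k - t%:C) = x k.
  have -> : t +i* x k - t%:C = 0 +i* x k.
    by apply/eqP; rewrite eq_complex /= subrr subr0 !eqxx.
  by rewrite /= expr0n add0r sqrtr_sqr gtr0_norm.
have fr : r <= normc (f (t +i* x k)).
  by apply/ltW/Hd2; rewrite x0 (le_lt_trans (xe k)).
apply: le_trans (Hr _ fr) _.
have := HK (t +i* x k) (f (t +i* x k)).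
rewrite zt P'f; last exact: Hpos.
rewrite sub0r normcN => /(_ (le_trans (xe k) (ltW e1))) h; apply: le_trans h _.
set Bn := (1 + A + Y + _) ^+ n.
have -> : K * e * Bn / 2 ^+ k = K * x k * Bn by rewrite /x; ring.
apply: ler_wpM2l; first by rewrite mulr_ge0 // ltW.
rewrite /Bn lerXn2r ?nnegrE ?addr_ge0 ?normr_ge0 ?normc_ge0 ?mulr_ge0 //.
have := normc_le (f (t +i* x k)); have := imY k; have := reY k.
lra.
Unshelve. all: by end_near. Qed.

End ImaginarySingularities.

(** * Stieltjes transforms *)

Section Stieltjes.
Context {R : realType}.
Local Notation C := R[i].
Local Notation H := (@upper_half_plane R).
Variable mu : probability (measurableTypeR R) R.

(** This and [conj_kernel] are the imaginary and real parts of [1 / (u - i e)]: the Poisson kernel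
    without its factor [1 / pi], and its conjugate. *)
Definition poisson_kernel (e u : R) : R := e / (u ^+ 2 + e ^+ 2).
Definition conj_kernel (e u : R) : R := u / (u ^+ 2 + e ^+ 2).

Lemma sqrD_gt0 (e u : R) : 0 < e -> 0 < u ^+ 2 + e ^+ 2.
Proof. by move=> e0; rewrite ltr_wpDl ?sqr_ge0 // exprn_gt0. Qed.

Lemma poisson_kernel_ge0 e u : 0 < e -> 0 <= poisson_kernel e u.
Proof. by move=> e0; rewrite divr_ge0 ?(ltW e0) // ltW // sqrD_gt0. Qed.

Lemma poisson_kernel_le e u : 0 < e -> poisson_kernel e u <= e^-1.
Proof.
move=> e0; rewrite /poisson_kernel ler_pdivrMr ?sqrD_gt0 //.
rewrite expr2 -[e ^+ 2]/(e * e) mulrDr mulKf ?gt_eqF // lerDr.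
by rewrite mulr_ge0 ?invr_ge0 ?(ltW e0) // -expr2 sqr_ge0.
Qed.

Lemma conj_kernel_le e u : 0 < e -> `|conj_kernel e u| <= e^-1.
Proof.
move=> e0; rewrite /conj_kernel normrM normfV (ger0_norm (ltW (sqrD_gt0 u e0))).
rewrite ler_pdivrMr ?sqrD_gt0 // mulrC ler_pdivlMr //.
have -> : u ^+ 2 = `|u| ^+ 2 by rewrite real_normK ?num_real.
by move: (normr_ge0 u) => u0; nra.
Qed.

Lemma kernel_continuous (e x : R) : 0 < e ->
  continuous (fun t => poisson_kernel e (t - x)) /\
  continuous (fun t => conj_kernel e (t - x)).
Proof.
move=> e0.
have cd : continuous (fun t : R => ((t - x) ^+ 2 + e ^+ 2)^-1).
  move=> t; apply: cvgV; first by rewrite gt_eqF // sqrD_gt0.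
  apply: cvgD; last exact: cvg_cst.
  by apply: (@continuous_comp _ _ _ (fun t => t - x) (fun u => u ^+ 2));
    [apply: cvgB; [exact: cvg_id|exact: cvg_cst]|exact: exprn_continuous].
split=> t; first by apply: cvgM; [exact: cvg_cst|exact: cd].
by apply: cvgM; [apply: cvgB; [exact: cvg_id|exact: cvg_cst]|exact: cd].
Qed.

Lemma bounded_integrable (g : R -> R) (B : R) : measurable_fun [set: R] g ->
  (forall t, `|g t| <= B) -> mu.-integrable setT (EFin \o g).
Proof.
move=> mg gB; apply: measurable_bounded_integrable => //.
  exact: le_lt_trans (probability_le1 mu measurableT) (ltry 1).
by exists B; split; [exact: num_real|move=> M BM t _ /=; apply: le_trans (ltW BM)].
Qed.

Lemma measurable_poisson e x : 0 < e ->
  measurable_fun [set: R] (fun t => poisson_kernel e (t - x)).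
Proof. by move=> e0; apply: continuous_measurable_fun; have [] := kernel_continuous x e0. Qed.

Lemma measurable_conj e x : 0 < e ->
  measurable_fun [set: R] (fun t => conj_kernel e (t - x)).
Proof. by move=> e0; apply: continuous_measurable_fun; have [] := kernel_continuous x e0. Qed.

Lemma integrable_poisson e x : 0 < e ->
  mu.-integrable setT (EFin \o (fun t => poisson_kernel e (t - x))).
Proof.
move=> e0; apply: (@bounded_integrable _ e^-1); first exact: measurable_poisson.
by move=> t; rewrite ger0_norm ?poisson_kernel_ge0 // poisson_kernel_le.
Qed.

Lemma integrable_conj e x : 0 < e ->
  mu.-integrable setT (EFin \o (fun t => conj_kernel e (t - x))).
Proof.
move=> e0; apply: (@bounded_integrable _ e^-1); first exact: measurable_conj.
by move=> t; rewrite conj_kernel_le.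
Qed.

Lemma resolvent_kernel (t x e : R) : 0 < e ->
  1 / (t%:C - (x +i* e)) = conj_kernel e (t - x) +i* poisson_kernel e (t - x).
Proof.
move=> e0; have d0 := sqrD_gt0 (t - x) e0.
have -> : t%:C - (x +i* e) = (t - x) +i* - e.
  by apply/eqP; rewrite eq_complex /= sub0r !eqxx.
rewrite div1r /conj_kernel /poisson_kernel.
apply/eqP; rewrite eq_complex /= sqrrN; apply/andP; split; apply/eqP => //.
by rewrite mulNr opprK.
Qed.

Lemma stieltjesE (x e : R) : 0 < e -> stieltjes mu (x +i* e) =
  (\int[mu]_t conj_kernel e (t - x)) +i* (\int[mu]_t poisson_kernel e (t - x)).
Proof.
move=> e0; rewrite /stieltjes /cintegral.
by congr (_ +i* _); apply: eq_Rintegral => t _; rewrite resolvent_kernel.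
Qed.

Lemma Im_stieltjes_ge0 z : H z -> 0 <= complex.Im (stieltjes mu z).
Proof.
case: z => x e e0.
by rewrite stieltjesE //=; apply: Rintegral_ge0 => t _; rewrite poisson_kernel_ge0.
Qed.

Lemma Rintegral_dist (g1 g2 h : R -> R) :
  mu.-integrable setT (EFin \o g1) -> mu.-integrable setT (EFin \o g2) ->
  mu.-integrable setT (EFin \o h) -> (forall t, `|g1 t - g2 t| <= h t) ->
  `|\int[mu]_t g1 t - \int[mu]_t g2 t| <= \int[mu]_t h t.
Proof.
move=> i1 i2 ih gh; rewrite -RintegralB //.
have iB : mu.-integrable setT (EFin \o (fun t => g1 t - g2 t)).
  by have := integrableB measurableT i1 i2; apply: eq_integrable.
apply: le_trans (le_normr_Rintegral measurableT iB) _.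
apply: le_Rintegral => //.
by have := integrable_norm iB; apply: eq_integrable.
Qed.

(** The bound holds for the kernels: after clearing denominators it reads
    [3/4 * |u| * e <= u^2 + e^2 / 4], a consequence of [0 <= (|u| - e / 2)^2]. *)
Lemma stieltjes_half (x e : R) : 0 < e ->
  `|complex.Re (stieltjes mu (x +i* (e / 2))) - complex.Re (stieltjes mu (x +i* e))|
    <= complex.Im (stieltjes mu (x +i* e)).
Proof.
move=> e0; have e20 : 0 < e / 2 by rewrite divr_gt0.
rewrite !stieltjesE //=; apply: Rintegral_dist; rewrite ?integrable_conj ?integrable_poisson //.
move=> t; move: (t - x) => u.
rewrite /conj_kernel /poisson_kernel.
have d1 := sqrD_gt0 u e20; have d2 := sqrD_gt0 u e0.
have -> : u / (u ^+ 2 + (e / 2) ^+ 2) - u / (u ^+ 2 + e ^+ 2) =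
   (u * (3 / 4 * e ^+ 2) / (u ^+ 2 + (e / 2) ^+ 2)) / (u ^+ 2 + e ^+ 2).
  by field; rewrite !gt_eqF //; nra.
rewrite normrM [`|_^-1|]gtr0_norm ?invr_gt0 // ler_wpM2r ?invr_ge0 ?(ltW d2) //.
rewrite normrM [`|_^-1|]gtr0_norm ?invr_gt0 // ler_pdivrMr //.
rewrite normrM [`|3 / 4 * _|]ger0_norm; last by rewrite mulr_ge0 ?sqr_ge0.
have -> : u ^+ 2 = `|u| ^+ 2 by rewrite real_normK ?num_real.
move: `|u| (normr_ge0 u) => {d1 d2} {}u u0.
have : 0 <= e * (u - e / 2) ^+ 2 by rewrite mulr_ge0 ?sqr_ge0 ?ltW.
have : 0 <= u * e ^+ 2 by rewrite mulr_ge0 ?sqr_ge0.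
rewrite !expr2; nra.
Qed.

Lemma stieltjes_lipschitz : halfplane_lipschitz (stieltjes mu).
Proof.
(* Each of the two resolvents contributes a factor [1 / c]; the 2 comes from estimating real and
   imaginary parts separately. *)
move=> c c0; exists (2 / c ^+ 2) => -[x e] [y d] ce cd.
have e0 : 0 < e := lt_le_trans c0 ce; have d0 : 0 < d := lt_le_trans c0 cd.
rewrite !stieltjesE //.
set N := normc ((x +i* e) - (y +i* d)); set L := N / c ^+ 2.
have key t : normc (1 / (t%:C - (x +i* e)) - 1 / (t%:C - (y +i* d))) <= L.
  have h (a b : R) : c <= b -> c <= normc (t%:C - (a +i* b)).
    move=> cb; apply: le_trans (Im_le_normc _); rewrite /= sub0r normrN.
    by rewrite (le_trans cb) // ler_norm.
  have hx := h x e ce; have hy := h y d cd.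
  have nz a : c <= normc a -> a != 0 :> C.
    by move=> ca; apply: contraTneq ca => ->; rewrite normc0 -ltNge.
  have -> : 1 / (t%:C - (x +i* e)) - 1 / (t%:C - (y +i* d)) =
    ((x +i* e) - (y +i* d)) / ((t%:C - (x +i* e)) * (t%:C - (y +i* d))).
    by field; rewrite !nz.
  rewrite normcM normcV normcM -/N /L ler_wpM2l ?normc_ge0 //.
  rewrite lef_pV2 ?posrE ?exprn_gt0 ?mulr_gt0 ?(lt_le_trans c0 hx) ?(lt_le_trans c0 hy) //.
  by rewrite expr2 ler_pM // ltW.
have iL : mu.-integrable setT (EFin \o (fun _ : R => L)).
  by apply: (@bounded_integrable _ `|L|) => //; exact: measurable_cst.
have intL : \int[mu]_t L = L.
  by rewrite Rintegral_cst // [X in fine X](@probability_setT _ _ _ mu) mulr1.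
apply: le_trans (normc_le _) _ => /=.
have -> : 2 / c ^+ 2 * N = L + L by rewrite /L; ring.
apply: lerD; rewrite -intL; apply: Rintegral_dist; rewrite ?integrable_conj ?integrable_poisson //.
  move=> t; have := key t; rewrite !resolvent_kernel //.
  by move=> /(le_trans (Re_le_normc _)).
move=> t; have := key t; rewrite !resolvent_kernel //.
by move=> /(le_trans (Im_le_normc _)).
Qed.

End Stieltjes.

(** * Stieltjes inversion *)

Section BoundedConvergence.
Context d (T : measurableType d) (R : realType) (mu : {measure set T -> \bar R}).

Lemma bounded_convergence (D : set T) (g_ : (T -> R)^nat) (g : T -> R) (B : R) :
  measurable D -> (mu D < +oo)%E -> (forall n, measurable_fun D (g_ n)) ->
  (forall n t, D t -> `|g_ n t| <= B) ->
  (forall t, D t -> g_ n t @[n --> \oo] --> g t) ->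
  mu.-integrable D (EFin \o g) /\
  (\int[mu]_(t in D) (g_ n t)%:E)%E @[n --> \oo] --> (\int[mu]_(t in D) (g t)%:E)%E.
Proof.
move=> mD Dfin mg gB gg.
have mgl : measurable_fun D g by exact: measurable_fun_cvg gg.
have iB : mu.-integrable D (EFin \o cst B).
  apply: measurable_bounded_integrable => //.
  by exists `|B|; split; [exact: num_real|move=> M BM t _ /=; apply: ltW].
have [] := @dominated_convergence _ _ _ mu D mD (fun n => EFin \o g_ n) (EFin \o g)
  (EFin \o cst B).
- by move=> n; apply/measurable_EFinP.
- exact/measurable_EFinP.
- apply: aeW => t Dt; apply: cvg_EFin; last exact: gg.
  by near=> n.
- exact: iB.
- by apply: aeW => t n Dt /=; rewrite lee_fin; apply: gB.
by move=> ig _ cg; split.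
Unshelve. all: by end_near. Qed.

End BoundedConvergence.

Section Inversion.
Context {R : realType}.
Local Notation C := R[i].
Local Notation lambda := (@lebesgue_measure R).

Lemma derive_atan_affine (e t x : R) : 0 < e ->
  is_derive x 1 (fun x => atan ((x - t) / e)) (poisson_kernel e (t - x)).
Proof.
move=> e0.
have h1 : is_derive x (1 : R) (fun x : R => (x - t) / e) e^-1.
  have -> : (fun x : R => (x - t) / e) = (fun x => e^-1 *: (x - t)).
    by apply/funext => y; rewrite mulrC.
  by apply: is_derive_eq; rewrite subr0 /GRing.scale /= mulr1.
refine (is_derive_eq (@is_derive1_comp _ atan _ x _ _ (is_derive1_atan ((x - t) / e)) h1) _).
have d0 := sqrD_gt0 (t - x) e0.
rewrite /poisson_kernel; field.
by rewrite !gt_eqF //; move: d0; nra.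
Qed.

Lemma integral_poisson_itv (a b e t : R) : a < b -> 0 < e ->
  (\int[lambda]_(x in `[a, b]) (poisson_kernel e (t - x))%:E =
    (atan ((b - t) / e) - atan ((a - t) / e))%:E)%E.
Proof.
move=> ab e0; pose F x := atan ((x - t) / e).
have dF x := derive_atan_affine t x e0.
have cF : continuous F.
  by move=> x; apply/differentiable_continuous/derivable1_diffP; have [] := dF x.
rewrite (@continuous_FTC2 _ _ F) //.
- apply: continuous_subspaceT => x.
  have [+ _] := kernel_continuous t e0 => /(_ x).
  by under eq_fun do rewrite /poisson_kernel -sqrrN opprB -/(poisson_kernel _ _).
- split.
  + by move=> x _; have [] := dF x.
  + exact/cvg_at_right_filter/cF.
  + exact/cvg_at_left_filter/cF.
- by move=> x _; rewrite derive1E; have [] := dF x.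
Qed.

Lemma cvg_atan_scaled (c : R) (u : R^nat) : (forall n, 0 < u n) ->
  u n @[n --> \oo] --> 0 ->
  atan (c / u n) @[n --> \oo] --> pi / 2 * Num.sg c.
Proof.
move=> u0 ul.
have pos (k : R) : 0 < k -> atan (k / u n) @[n --> \oo] --> pi / 2.
  move=> k0; apply: (@cvg_comp _ _ _ (fun n => k / u n) atan _ +oo%R); last exact: cvgy_atan.
  apply/cvgryPgt => M.
  have M0 : 0 < `|M| + 1 by rewrite ltr_wpDl.
  have : 0 < k / (`|M| + 1) by rewrite divr_gt0.
  move/cvgr_lt: ul => /[apply]; apply: filterS => n.
  rewrite ltr_pdivlMr // mulrC -ltr_pdivlMr //; apply: le_lt_trans.
  by rewrite (le_trans (ler_norm _)) // lerDl.
case: (ltrgt0P c) => c0.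
- by rewrite gtr0_sg // mulr1; exact: pos.
- rewrite ltr0_sg // mulrN1.
  have nc0 : 0 < - c by rewrite oppr_gt0.
  rewrite (_ : (fun n => atan (c / u n)) = (fun n => - atan (- c / u n))).
    by apply: cvgN; exact: pos.
  by apply/funext => n; rewrite -atanN mulNr opprK.
- rewrite c0 sgr0 mulr0; apply: cvg_near_cst; near=> n.
  by rewrite mul0r atan0.
Unshelve. all: by end_near. Qed.

Variable mu : probability (measurableTypeR R) R.
Local Notation m := (stieltjes mu).

Lemma mu_lty (A : set (measurableTypeR R)) : measurable A -> (mu A < +oo)%E.
Proof. by move=> mA; exact: le_lt_trans (probability_le1 mu mA) (ltry 1). Qed.

Lemma mu_fin (A : set (measurableTypeR R)) : measurable A -> mu A \is a fin_num.
Proof. by move=> mA; rewrite ge0_fin_numE ?measure_ge0 ?mu_lty. Qed.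

Lemma Im_stieltjesE (x e : R) : 0 < e ->
  (complex.Im (m (x +i* e)))%:E = (\int[mu]_t (poisson_kernel e (t - x))%:E)%E.
Proof.
move=> e0; rewrite stieltjesE //= /Rintegral fineK //.
have /integrableP [_] := integrable_poisson mu x e0.
by move=> h; apply: integrable_fin_num => //; exact: integrable_poisson.
Qed.

Lemma poisson_scaled (e u : R) : 0 < e -> u != 0 ->
  0 <= e * poisson_kernel e u <= (e / u) ^+ 2.
Proof.
move=> e0 u0; rewrite mulr_ge0 ?poisson_kernel_ge0 ?(ltW e0) //=.
have u20 : 0 < u ^+ 2 by rewrite exprn_even_gt0.
have -> : e * poisson_kernel e u = e ^+ 2 * (u ^+ 2 + e ^+ 2)^-1.
  by rewrite /poisson_kernel mulrA expr2.
rewrite expr_div_n; apply: ler_wpM2l; first exact: sqr_ge0.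
by rewrite lef_pV2 ?posrE ?sqrD_gt0 // lerDl sqr_ge0.
Qed.

(** The kernels [e * poisson_kernel e (t - x)] are bounded by 1 and tend to the indicator of [x]. *)
Lemma scaled_im_cvg (x : R) :
  scaled_im m x e @[e --> 0^'+] --> fine (mu [set x]).
Proof.
apply/cvg_at_rightP => u [u0 ul].
have [||||_] := @bounded_convergence _ _ _ mu setT
    (fun n t => u n * poisson_kernel (u n) (t - x)) (\1_[set x]) 1 measurableT.
- exact: mu_lty.
- by move=> n; apply: measurable_funM => //; exact: measurable_poisson.
- move=> n t _; rewrite ger0_norm; last first.
    exact: mulr_ge0 (ltW (u0 n)) (poisson_kernel_ge0 _ (u0 n)).
  rewrite -(@divff _ (u n)) ?gt_eqF //; apply: ler_wpM2l; first exact: ltW.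
  exact: poisson_kernel_le.
- move=> t _; rewrite indicE; have [->|tx] := eqVneq t x.
    rewrite mem_set //= subrr; apply: cvg_near_cst; near=> n.
    by rewrite /poisson_kernel expr0n add0r; field; rewrite gt_eqF.
  rewrite memNset /= ?mulr0n; last by move/eqP; rewrite (negPf tx).
  have tx0 : t - x != 0 by rewrite subr_eq0.
  apply: (@squeeze_cvgr _ _ _ _ (fun=> 0) (fun n => (u n / (t - x)) ^+ 2)).
  - by near=> n; apply: poisson_scaled.
  - exact: cvg_cst.
  - have E0 : (0 / (t - x)) ^+ 2 = 0 by rewrite mul0r expr0n.
    rewrite -[X in _ --> X]E0.
    apply: (@cvg_comp _ _ _ (fun n => u n / (t - x)) (fun y => y ^+ 2)); last exact: exprn_continuous.
    by apply: cvgM ul _; exact: cvg_cst.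
rewrite integral_indic // setIT => h.
have h' : (\int[mu]_t (u n * poisson_kernel (u n) (t - x))%:E)%E @[n --> \oo] -->
    (fine (mu [set x]))%:E.
  by rewrite fineK ?mu_fin //; exact: h.
apply: cvg_trans (fine_cvg h'); apply: near_eq_cvg; near=> n.
rewrite /scaled_im stieltjesE //= -RintegralZl //.
exact: integrable_poisson.
Unshelve. all: by end_near. Qed.

(** The scaled kernel is nonnegative and equals 1 at its center, so the bound holds at every height.
    It makes the imaginary part nonnegative above an atom even after the pole has been
    subtracted. *)
Lemma scaled_im_ge (x e : R) : 0 < e -> fine (mu [set x]) <= scaled_im m x e.
Proof.
move=> e0; rewrite /scaled_im stieltjesE //= -RintegralZl //; last exact: integrable_poisson.
have <- : \int[mu]_t \1_[set x] t = fine (mu [set x]).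
  by rewrite /Rintegral integral_indic // setIT.
apply: le_Rintegral => //.
- apply: (@bounded_integrable _ _ _ 1) => // t.
  by rewrite indicE; case: (_ \in _); rewrite ?normr1 ?normr0.
- apply: (@bounded_integrable _ _ _ 1).
    by apply: measurable_funM => //; exact: measurable_poisson.
  move=> t; rewrite ger0_norm; last exact: mulr_ge0 (ltW e0) (poisson_kernel_ge0 _ e0).
  rewrite -(@divff _ e) ?gt_eqF //; apply: ler_wpM2l; first exact: ltW.
  exact: poisson_kernel_le.
- move=> t _; rewrite indicE; have [->|tx] := eqVneq t x.
    rewrite mem_set //= subrr /poisson_kernel expr0n add0r.
    by rewrite le_eqVlt; apply/orP; left; apply/eqP; field; rewrite gt_eqF.
  rewrite memNset /=; last by move/eqP; rewrite (negPf tx).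
  exact: mulr_ge0 (ltW e0) (poisson_kernel_ge0 _ e0).
Qed.

Lemma continuous_Im_stieltjes (e : R) : 0 < e ->
  continuous (fun x => complex.Im (m (x +i* e))).
Proof.
move=> e0 x; have [L HL] := stieltjes_lipschitz mu e0.
apply/cvgrPdist_lt => d d0; near=> y.
have xy : normc ((x +i* e) - (y +i* e)) = `|x - y|.
  have -> : (x +i* e) - (y +i* e) = (x - y)%:C.
    by apply/eqP; rewrite eq_complex /= subrr !eqxx.
  exact: normcR.
have := HL (x +i* e) (y +i* e) (lexx e) (lexx e); rewrite xy => h.
have {}h : `|complex.Im (m (x +i* e)) - complex.Im (m (y +i* e))| <= (`|L| + 1) * `|x - y|.
  have := Im_le_normc (m (x +i* e) - m (y +i* e)).
  have -> : complex.Im (m (x +i* e) - m (y +i* e)) =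
      complex.Im (m (x +i* e)) - complex.Im (m (y +i* e)).
    by case: (m (x +i* e)) => ? ?; case: (m (y +i* e)).
  move=> /le_trans /(_ h) /le_trans; apply; rewrite ler_wpM2r //.
  by rewrite (le_trans (ler_norm _)) // lerDl.
apply: le_lt_trans h _; rewrite -ltr_pdivlMl ?ltr_wpDl //.
near: y; apply: cvgr_dist_lt => //.
by rewrite mulr_gt0 // invr_gt0 ltr_wpDl.
Unshelve. all: by end_near. Qed.

Lemma integral_Im_stieltjes (a b e : R) : a < b -> 0 < e ->
  (\int[lambda]_(x in `[a, b]) (complex.Im (m (x +i* e)))%:E =
   \int[mu]_t (atan ((b - t) / e) - atan ((a - t) / e))%:E)%E.
Proof.
move=> ab e0.
pose f (xt : measurableTypeR R * measurableTypeR R) : \bar R :=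
  (poisson_kernel e (xt.2 - xt.1) * \1_(`[a, b]%classic) xt.1)%:E.
have mf : measurable_fun setT f.
  apply/measurable_EFinP; apply: measurable_funM.
    have mp : measurable_fun [set: R] (poisson_kernel e).
      have := measurable_poisson 0 e0.
      by under eq_fun do rewrite subr0.
    apply: (measurableT_comp mp).
    by apply: measurable_funB; [exact: measurable_snd|exact: measurable_fst].
  have m1 : measurable_fun [set: R] (\1_(`[a, b]%classic) : R -> R).
    exact: measurable_indic.
  exact: (measurableT_comp m1 measurable_fst).
have f0 xt : (0 <= f xt)%E.
  rewrite lee_fin; apply: mulr_ge0; first exact: poisson_kernel_ge0.
  by rewrite indicE.
have := @fubini_tonelli _ _ _ _ _ lambda mu f mf f0.
have -> : (\int[lambda]_x \int[mu]_t f (x, t))%E =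
    (\int[lambda]_(x in `[a, b]) (complex.Im (m (x +i* e)))%:E)%E.
  rewrite [RHS]integral_mkcond; apply: eq_integral => x _.
  rewrite patchE /f /= indicE; case: (x \in _) => /=; last first.
    by under eq_integral do rewrite mulr0; rewrite integral0.
  under eq_integral do rewrite mulr1.
  by rewrite Im_stieltjesE.
move=> ->; apply: eq_integral => t _.
rewrite -integral_poisson_itv // [RHS]integral_mkcond; apply: eq_integral => x _.
by rewrite patchE /f /= indicE; case: (x \in _); rewrite /= ?mulr1 ?mulr0.
Qed.

(** By Tonelli the integral over [[a, b]] at height [e] is a [mu]-integral of a difference of
    arctangents. Bounded convergence applies on both sides as [e] tends to 0. *)
Lemma stieltjes_inversion (a b B e1 : R) (g : R -> R) : a < b -> 0 < e1 ->
  mu [set a] = 0%E -> mu [set b] = 0%E ->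
  (forall x e, a <= x <= b -> 0 < e < e1 -> `|complex.Im (m (x +i* e))| <= B) ->
  (forall x, a <= x <= b -> complex.Im (m (x +i* e)) @[e --> 0^'+] --> g x) ->
  lambda.-integrable `[a, b] (EFin \o g) /\
  (\int[lambda]_(x in `[a, b]) (g x)%:E = pi%:E * mu (`]a, b]%classic : set R))%E.
Proof.
move=> ab e10 mua mub mB mg.
(* The shift by 2 keeps [u n] strictly below [e1] from [n = 0] on. *)
pose u n := e1 / n.+2%:R.
have u0 n : 0 < u n by rewrite divr_gt0.
have ue n : 0 < u n < e1.
  by rewrite u0 /= ltr_pdivrMr // ltr_pMr // ltr1n.
have ul : u n @[n --> \oo] --> 0.
  rewrite -[X in _ --> X](mulr0 e1); apply: cvgM; first exact: cvg_cst.
  by have := @cvg_harmonic R; rewrite -cvg_shiftS.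
have inab x : `[a, b]%classic x -> a <= x <= b by rewrite /= in_itv.
have lab : (lambda `[a, b]%classic < +oo)%E.
  by rewrite lebesgue_measure_itv /= lte_fin ab -EFinB ltry.
have [ig cg] := @bounded_convergence _ _ _ lambda `[a, b]%classic
   (fun n x => complex.Im (m (x +i* u n))) g B (measurable_itv _) lab
   (fun n => measurable_funTS (continuous_measurable_fun (continuous_Im_stieltjes (u0 n))))
   (fun n x xab => mB x (u n) (inab x xab) (ue n))
   (fun x xab => (cvg_at_rightP _ _ _).1 (mg x (inab x xab)) u (conj u0 ul)).
split=> //.
(* [h] is [pi] strictly between [a] and [b], 0 outside and [pi / 2] at the endpoints, which carry no
   mass. *)
pose h t : R := pi / 2 * Num.sg (b - t) - pi / 2 * Num.sg (a - t).
have [||||ih ch] := @bounded_convergence _ _ _ mu setT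
   (fun n t => atan ((b - t) / u n) - atan ((a - t) / u n)) h pi measurableT.
- exact: mu_lty.
- move=> n; apply: continuous_measurable_fun => t.
  have cat c : (fun t => atan ((c - t) / u n)) s @[s --> t] --> atan ((c - t) / u n).
    apply: (@cvg_comp _ _ _ (fun s => (c - s) / u n) atan); last exact: continuous_atan.
    by apply: cvgM; [apply: cvgB; [exact: cvg_cst|exact: cvg_id]|exact: cvg_cst].
  by apply: cvgB; exact: cat.
- move=> n t _; rewrite ler_norml.
  have := atan_gtNpi2 ((b - t) / u n); have := atan_ltpi2 ((b - t) / u n).
  have := atan_gtNpi2 ((a - t) / u n); have := atan_ltpi2 ((a - t) / u n).
  lra.
- by move=> t _; apply: cvgB; exact: cvg_atan_scaled.
have -> : (\int[lambda]_(x in `[a, b]) (g x)%:E = \int[mu]_t (h t)%:E)%E.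
  apply: cvg_unique cg _; first exact: ereal_hausdorff.
  apply: cvg_trans ch; apply: near_eq_cvg; near=> n.
  by rewrite integral_Im_stieltjes.
have -> : (\int[mu]_t (h t)%:E = \int[mu]_t (pi * \1_(`]a, b]%classic) t)%:E)%E.
  have mI : measurable (`]a, b]%classic : set (measurableTypeR R)) by exact: measurable_itv.
  apply: ae_eq_integral => //; first exact: measurable_int ih.
    by apply/measurable_EFinP; apply: measurable_funM => //; exact: measurable_indic.
  exists ([set a] `|` [set b]); split.
  - exact: measurableU.
  - by apply: null_set_setU.
  move=> t /= nt; apply: contrapT => nab; apply: nt => _.
  have ta : a - t != 0 by rewrite subr_eq0; apply/eqP => at_; apply: nab; left.
  have tb : b - t != 0 by rewrite subr_eq0; apply/eqP => bt; apply: nab; right.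
  congr EFin; rewrite /h indicE.
  have [at_|ta'] := ltP a t; last first.
    rewrite memNset; last by rewrite /= in_itv /= ltNge ta'.
    have {}ta' : t < a.
      by rewrite lt_neqAle ta' andbT eq_sym -subr_eq0.
    have h1 : Num.sg (a - t) = 1 by rewrite gtr0_sg // subr_gt0.
    have h2 : Num.sg (b - t) = 1 by rewrite gtr0_sg // subr_gt0 (lt_trans ta').
    by rewrite h1 h2 subrr mulr0.
  have [tb'|bt] := ltP t b; last first.
    rewrite memNset; last first.
      rewrite /= in_itv /= at_ /= => tb'; apply: nab; right => /=.
      by apply/eqP; rewrite eq_le tb'.
    have {}bt : b < t.
      by rewrite lt_neqAle bt andbT -subr_eq0.
    have h1 : Num.sg (a - t) = -1 by rewrite ltr0_sg // subr_lt0.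
    have h2 : Num.sg (b - t) = -1 by rewrite ltr0_sg // subr_lt0.
    by rewrite h1 h2 subrr mulr0.
  rewrite mem_set; last by rewrite /= in_itv /= at_ ltW.
  have h1 : Num.sg (a - t) = -1 by rewrite ltr0_sg // subr_lt0.
  have h2 : Num.sg (b - t) = 1 by rewrite gtr0_sg // subr_gt0.
  by rewrite h1 h2 /=; field.
have iI : mu.-integrable setT (EFin \o \1_(`]a, b]%classic)).
  apply: (@bounded_integrable _ _ _ 1); first exact: measurable_indic.
  by move=> t; rewrite indicE; case: (_ \in _); rewrite ?normr1 ?normr0.
under eq_integral do rewrite EFinM.
by rewrite integralZl // integral_indic // setIT.
Unshelve. all: by end_near. Qed.

End Inversion.

(** * Comparison of a measure with a density *)

Section DensityMeasure.
Context d (T : measurableType d) (R : realType) (mu : {measure set T -> \bar R}).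
Variable v : T -> \bar R.
Hypotheses (mv : measurable_fun setT v) (v0 : forall x, (0 <= v x)%E).

(** The two proofs are arguments because the measure structure attached to this function depends on
    them. *)
Definition density_measure of measurable_fun setT v & (forall x, (0 <= v x)%E) :=
  fun B : set T => (\int[mu]_(x in B) v x)%E.

Local Notation nu := (density_measure mv v0).

Let nu0 : nu set0 = 0%E. Proof. exact: integral_set0. Qed.

Let nu_ge0 B : (0 <= nu B)%E. Proof. by apply: integral_ge0. Qed.

Let nu_sigma_additive : semi_sigma_additive nu.
Proof.
move=> F mF tF mUF; rewrite /density_measure ge0_integral_bigcup //; last first.
  exact: measurable_funTS.
by apply: is_cvg_ereal_nneg_natsum_cond => n _ _; exact: integral_ge0.
Qed.

HB.instance Definition _ := isMeasure.Build _ _ _ nu nu0 nu_ge0 nu_sigma_additive.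

End DensityMeasure.

Section MeasureComparison.
Context {R : realType}.
Local Notation lambda := (@lebesgue_measure R).
Variables (mu : probability (measurableTypeR R) R) (v : R -> \bar R).
Hypotheses (mv : measurable_fun [set: measurableTypeR R] v).
Hypothesis v0 : forall x, (0 <= v x)%E.

(** Restricted to []p, q]], both sides are measures that agree on half-open intervals; these are
    stable under intersection and generate the Borel sets. *)
Lemma measure_density_itv (p q : R) :
  (forall a b : R, p <= a -> b <= q -> a < b ->
    mu `]a, b]%classic = (\int[lambda]_(x in `]a, b]) v x)%E) ->
  forall B : set (measurableTypeR R), measurable B ->
    mu (B `&` `]p, q]%classic) = (\int[lambda]_(x in B `&` `]p, q]%classic) v x)%E.
Proof.
move=> Hab B mB.
have mI : measurable (`]p, q]%classic : set (measurableTypeR R)) by exact: measurable_itv.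
pose m1 : {measure set (measurableTypeR R) -> \bar R} := mrestr mu mI.
pose m2 : {measure set (measurableTypeR R) -> \bar R} :=
  mrestr (density_measure lambda mv v0) mI.
rewrite -[LHS]/(m1 B) -[RHS]/(m2 B).
have uniq := @measure_unique _ R (measurableTypeR R) (@ocitv R)
  (fun k => `](- k%:R), k%:R]%classic) erefl (@ocitvI R).
apply: (uniq _ _ m1 m2) => //.
- by move=> k; exists (- k%:R, k%:R).
- apply/seteqP; split=> // x _; exists (Num.bound x) => //=.
  rewrite in_itv /=; have := archi_boundP (normr_ge0 x) => h.
  have -> : Num.bound x = Num.bound `|x|.
    by rewrite /Num.bound normr_id.
  by have := lt_le_trans h (lexx _); rewrite ltr_norml => /andP[-> /ltW ->].
- move=> _ [[x y] _ /= <-].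
  have -> : m1 `]x, y]%classic = mu (`]x, y] `&` `]p, q])%classic by [].
  have -> : m2 `]x, y]%classic = (\int[lambda]_(x in (`]x, y] `&` `]p, q])%classic) v x)%E by [].
  have -> : (`]x, y] `&` `]p, q] = `](Num.max x p), (Num.min y q)])%classic.
    apply/seteqP; split=> t /=; rewrite !in_itv /= gt_max le_min.
      by move=> [/andP[-> ->] /andP[-> ->]].
    by move=> /andP[/andP[-> ->] /andP[-> ->]].
  have [xy|xy] := ltP (Num.max x p) (Num.min y q); last first.
    by rewrite set_itv_ge -?leNgt // integral_set0 measure0.
  by apply: Hab => //; rewrite ?le_max ?ge_min lexx orbT.
- move=> k; apply: le_lt_trans (ltry 1).
  exact: (probability_le1 mu (measurableI _ _ (measurable_itv _) mI)).
Qed.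

(* Rational endpoints make the family of intervals on which the two sides are
   compared countable. *)
Lemma measure_density_open (U : set R) :
  measurable (U : set (measurableTypeR R)) ->
  (forall x, U x -> exists p q : R, [/\ p < x < q, `]p, q]%classic `<=` U &
     forall a b : R, p <= a -> b <= q -> a < b ->
       mu `]a, b]%classic = (\int[lambda]_(x in `]a, b]) v x)%E]) ->
  forall B : set (measurableTypeR R), measurable B ->
    mu (B `&` U) = (\int[lambda]_(x in B `&` U) v x)%E.
Proof.
move=> mU HU B mB.
pose J (r : rat * rat) : set R := `](ratr r.1), (ratr r.2)]%classic.
pose good (r : rat * rat) := J r `<=` U /\ forall a b : R, ratr r.1 <= a -> b <= ratr r.2 ->
  a < b -> mu `]a, b]%classic = (\int[lambda]_(x in `]a, b]) v x)%E.
pose F (n : nat) : set (measurableTypeR R) :=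
  if unpickle n is Some r then (if `[< good r >] then J r else set0) else set0.
have mF n : measurable (F n).
  rewrite /F; case: (unpickle n) => // r; case: ifP => // _; exact: measurable_itv.
have FU : U = \bigcup_n F n.
  apply/seteqP; split=> [x Ux|x [n _]]; last first.
    by rewrite /F; case: (unpickle n) => // r; case: ifP => // /asboolP [+ _]; exact.
  have [p [q [/andP[px xq] pqU Hpq]]] := HU x Ux.
  have [r1] := rat_in_itvoo px; rewrite in_itv /= => /andP[pr1 r1x].
  have [r2] := rat_in_itvoo xq; rewrite in_itv /= => /andP[xr2 r2q].
  have gr : good (r1, r2).
    split=> [y /=|a b /= r1a br2 ab].
      rewrite /J /= in_itv /= => /andP[r1y yr2]; apply: pqU; rewrite /= in_itv /=.
      by rewrite (lt_trans pr1) // (le_trans yr2) // ltW.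
    by apply: Hpq => //; [rewrite (le_trans (ltW pr1))|rewrite (le_trans br2) // ltW].
  have FE r : good r -> F (pickle r) = J r.
    by move=> gr'; rewrite /F pickleK asboolT.
  exists (pickle (r1, r2)); first exact: I.
  by rewrite FE // /J /= in_itv /= r1x ltW.
have key n (E : set (measurableTypeR R)) : measurable E -> E `<=` F n ->
    mu E = (\int[lambda]_(x in E) v x)%E.
  move=> mE; rewrite /F; case: (unpickle n) => [r|]; last first.
    by rewrite subset0 => ->; rewrite integral_set0 measure0.
  case: ifP => [/asboolP [_ gr] EI|_]; last first.
    by rewrite subset0 => ->; rewrite integral_set0 measure0.
  by have := measure_density_itv gr mE; rewrite -/(J r) setIidl.
(* The intervals of the cover overlap; [seqDU] makes it disjoint, so that countable additivity
   applies. *)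
pose D n : set (measurableTypeR R) := B `&` seqDU F n.
have mS n : measurable (seqDU F n).
  by apply: measurableD => //; apply: bigsetU_measurable => i _; exact: mF.
have mD n : measurable (D n) by apply: measurableI.
have tD : trivIset setT D.
  by apply: trivIset_setIl; exact: trivIset_seqDU.
have -> : B `&` U = \bigcup_n D n.
  by rewrite FU seqDU_bigcup_eq setI_bigcupr.
rewrite ge0_integral_bigcup //; last exact: measurable_funTS.
rewrite measure_semi_bigcup //; last exact: bigcup_measurable.
apply: eq_eseriesr => n _; apply: (key n) => //.
by move=> x [_]; exact: subset_seqDU.
Qed.

End MeasureComparison.

(** * Decomposition into a density and atoms *)

Section Decomposition.
Context {R : realType}.
Local Notation C := R[i].
Local Notation H := (@upper_half_plane R).
Local Notation lambda := (@lebesgue_measure R).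
Variables (mu : probability (measurableTypeR R) R) (f : C -> C).
Hypothesis fE : forall z, H z -> f z = stieltjes mu z.

Lemma transform_lipschitz : halfplane_lipschitz f.
Proof.
move=> c c0; have [L HL] := stieltjes_lipschitz mu c0.
exists L => z w cz cw; rewrite !fE; first exact: HL.
  exact: lt_le_trans cw.
exact: lt_le_trans cz.
Qed.

Lemma transform_Im_ge0 z : H z -> 0 <= complex.Im (f z).
Proof. by move=> Hz; rewrite fE //; exact: Im_stieltjes_ge0. Qed.

Lemma transform_half (t eta : R) : 0 < eta ->
  `|complex.Re (f (t +i* (eta / 2))) - complex.Re (f (t +i* eta))|
    <= complex.Im (f (t +i* eta)).
Proof.
move=> e0; rewrite !fE; [exact: stieltjes_half|exact: e0|].
by rewrite /upper_half_plane /= divr_gt0.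
Qed.

Lemma scaled_imE (t e : R) : 0 < e -> scaled_im f t e = scaled_im (stieltjes mu) t e.
Proof. by move=> e0; rewrite /scaled_im fE. Qed.

Lemma transform_scaled_im_cvg (t : R) :
  scaled_im f t e @[e --> 0^'+] --> fine (mu [set t]).
Proof.
have h := @scaled_im_cvg _ mu t.
apply: cvg_trans h; apply: near_eq_cvg; near=> e.
by rewrite scaled_imE //; near: e; exact: nbhs_right_gt.
Unshelve. all: by end_near. Qed.

Lemma atom_weightE (t : R) : atom_weight f t = fine (mu [set t]).
Proof. by apply: cvg_lim => //; exact: transform_scaled_im_cvg. Qed.

Lemma atom_weight_ge0 (t : R) : 0 <= atom_weight f t.
Proof. by rewrite atom_weightE fine_ge0. Qed.

Lemma atom_weight_le (t e : R) : 0 < e -> atom_weight f t <= scaled_im f t e.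
Proof. by move=> e0; rewrite atom_weightE scaled_imE // scaled_im_ge. Qed.

Hypothesis f_alg : algebraic_on H f.

Variable bv : R -> C.
Hypothesis bvP : forall t, ~ sing_set f t ->
  forall e : R, 0 < e -> near_point H t%:C (fun z => normc (f z - bv t) < e).

Lemma nonsingular_atom_weight (t : R) : ~ sing_set f t -> mu [set t] = 0%E.
Proof.
move=> nt; rewrite -(fineK (mu_fin mu (measurable_set1 t))); congr EFin.
apply: (cvg_unique (@Rhausdorff R) (@transform_scaled_im_cvg t)); rewrite /=.
have := near_point_vertical (bvP nt ltr01) => hb.
apply: (@squeeze_cvgr _ _ _ _ (fun=> 0) (fun e => e * (normc (bv t) + 1))).
- near=> e; have e0 : 0 < e by near: e; exact: nbhs_right_gt.
  rewrite /scaled_im mulr_ge0 ?(ltW e0) ?transform_Im_ge0 //=.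
  apply: ler_wpM2l; first exact: ltW.
  have h : normc (f (t +i* e) - bv t) < 1 by near: e; exact: hb.
  rewrite (le_trans (ler_norm _)) // (le_trans (Im_le_normc _)) //.
  have := le_normcD (f (t +i* e) - bv t) (bv t); rewrite subrK; lra.
- exact: cvg_cst.
- rewrite -[X in _ --> X](mul0r (normc (bv t) + 1)).
  by apply: cvgM; [exact/cvg_at_right_filter/cvg_id|exact: cvg_cst].
Unshelve. all: by end_near. Qed.

Variable ts : seq R.
Hypotheses (ts_uniq : uniq ts) (tsP : forall t, t \in ts <-> sing_set f t).

Lemma im_without_polesE (t e : R) : 0 < e -> im_without_poles f ts t e =
  complex.Im (f (t +i* e)) - \sum_(s <- ts) atom_weight f s * poisson_kernel e (s - t).
Proof.
move=> e0; rewrite /im_without_poles.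
have -> : complex.Im (f (t +i* e) - \sum_(s <- ts) (atom_weight f s)%:C / (s%:C - t +i* e))
  = complex.Im (f (t +i* e)) - complex.Im (\sum_(s <- ts) (atom_weight f s)%:C / (s%:C - t +i* e)).
  by case: (f _) => ? ?; case: (\sum_(_ <- _) _) => ? ?.
congr (_ - _); elim: ts => [|s l IH]; first by rewrite !big_nil.
rewrite !big_cons -IH; set S := \sum_(_ <- _) _.
have -> : (atom_weight f s)%:C / (s%:C - t +i* e) =
   (atom_weight f s * conj_kernel e (s - t)) +i* (atom_weight f s * poisson_kernel e (s - t)).
  rewrite -[in LHS](mul1r (_ - _)^-1) resolvent_kernel //.
  by apply/eqP; rewrite eq_complex /=; apply/andP; split; apply/eqP; ring.
by case: S.
Qed.

Lemma poisson_vanish (u : R) : u != 0 -> poisson_kernel e u @[e --> 0^'+] --> 0.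
Proof.
move=> u0.
have u20 : 0 < u ^+ 2 by rewrite exprn_even_gt0.
apply: (@squeeze_cvgr _ _ _ _ (fun=> 0) (fun e => e * (u ^+ 2)^-1)).
- near=> e; have e0 : 0 < e by near: e; exact: nbhs_right_gt.
  rewrite poisson_kernel_ge0 //=; apply: ler_wpM2l; first exact: ltW.
  by rewrite lef_pV2 ?posrE ?sqrD_gt0 // lerDl sqr_ge0.
- exact: cvg_cst.
- rewrite -[X in _ --> X](mul0r (u ^+ 2)^-1).
  by apply: cvgM; [exact/cvg_at_right_filter/cvg_id|exact: cvg_cst].
Unshelve. all: by end_near. Qed.

Lemma other_poles_vanish (t : R) (l : seq R) : t \notin l ->
  \sum_(s <- l) atom_weight f s * poisson_kernel e (s - t) @[e --> 0^'+] --> 0.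
Proof.
elim: l => [|s l IH].
  by move=> _; under eq_fun do rewrite big_nil; exact: cvg_cst.
rewrite inE negb_or => /andP[ts_ /IH h].
have -> : (fun e => \sum_(s <- s :: l) atom_weight f s * poisson_kernel e (s - t)) =
    (fun e => atom_weight f s * poisson_kernel e (s - t) +
      \sum_(s <- l) atom_weight f s * poisson_kernel e (s - t)).
  by apply/funext => e; rewrite big_cons.
rewrite -[X in _ --> X]addr0; apply: cvgD h.
rewrite -[X in _ --> X](mulr0 (atom_weight f s)); apply: cvgM; first exact: cvg_cst.
by apply: poisson_vanish; rewrite subr_eq0 eq_sym.
Qed.

Lemma nonsingular_Im_cvg (t : R) : ~ sing_set f t ->
  complex.Im (f (t +i* e)) @[e --> 0^'+] --> complex.Im (bv t).
Proof.
move=> nt; apply/cvgrPdist_lt => e e0.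
apply: filterS (near_point_vertical (bvP nt e0)) => x; apply: le_lt_trans.
rewrite distrC; apply: le_trans (Im_le_normc _).
by case: (f _) (bv t) => ? ? [].
Qed.

Lemma nonsingular_im_without_poles (t : R) : ~ sing_set f t ->
  im_without_poles f ts t e @[e --> 0^'+] --> complex.Im (bv t).
Proof.
move=> nt.
have tn : t \notin ts by apply/negP => /tsP.
have : complex.Im (f (t +i* e)) -
  \sum_(s <- ts) atom_weight f s * poisson_kernel e (s - t) @[e --> 0^'+]
    --> complex.Im (bv t) - 0.
  by apply: cvgB; [exact: nonsingular_Im_cvg|exact: other_poles_vanish].
rewrite subr0; apply: cvg_trans; apply: near_eq_cvg; near=> e.
by rewrite im_without_polesE //; near: e; exact: nbhs_right_gt.
Unshelve. all: by end_near. Qed.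

Lemma nonsingular_density (t : R) : ~ sing_set f t ->
  density f ts t = (pi^-1 * complex.Im (bv t))%:E.
Proof.
move=> nt; rewrite /density EFinM; congr (_ * _)%E.
apply: cvg_lim => //; apply: cvg_EFin; first by near=> e.
exact: nonsingular_im_without_poles.
Unshelve. all: by end_near. Qed.

(** At a point of [ts] the dichotomy for imaginary parts is applied to [f] minus the pole at that
    point. This function is still algebraic, and by [atom_weight_le] its imaginary part above the
    point is nonnegative, so an infinite limit is [+oo]. The other poles vanish in the limit. *)
Lemma im_without_poles_limit (t : R) : exists2 L : \bar R, (0 <= L)%E &
  (im_without_poles f ts t e)%:E @[e --> 0^'+] --> L.
Proof.
have [tts|tts] := boolP (t \in ts); last first.
  have nt : ~ sing_set f t by move/tsP; apply/negP.
  exists (complex.Im (bv t))%:E.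
    rewrite lee_fin; apply: (cvgr_to_ge (@nonsingular_Im_cvg t nt)).
    by near=> e; apply: transform_Im_ge0; near: e; exact: nbhs_right_gt.
  by apply: cvg_EFin; [near=> e|exact: nonsingular_im_without_poles].
pose D := atom_weight f t.
pose g z := f z - D%:C / (t%:C - z).
have Img e : 0 < e -> complex.Im (g (t +i* e)) =
    complex.Im (f (t +i* e)) - D * poisson_kernel e (t - t).
  move=> e0; rewrite /g -[D%:C]mulr1 -mulrA resolvent_kernel //.
  by case: (f _) => x y /=; ring.
have g_alg : algebraic_on H g.
  have [P P0 Pf] := f_alg.
  have [Q Q0 HQ] := annihilator_sub P0 (pole_poly2_neq0 t%:C D%:C).
  exists Q => // z Hz; apply: (HQ _ _ _ (Pf _ Hz)); apply: pole_poly2_horner.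
  by apply: contraPneq Hz => ->; exact: not_upper_real.
have g_lip : halfplane_lipschitz g.
  move=> c c0; have [L HL] := transform_lipschitz c0.
  exists (L + D / c ^+ 2) => z w cz cw.
  have hz x : c <= complex.Im x -> c <= normc (t%:C - x).
    move=> cx; apply: le_trans (Im_le_normc _); case: x cx => a b /= cx.
    by rewrite sub0r normrN (le_trans cx) // ler_norm.
  have nz a : c <= normc a -> a != 0 :> C.
    by move=> ca; apply: contraTneq ca => ->; rewrite normc0 -ltNge.
  have -> : g z - g w = (f z - f w) + - (D%:C * ((z - w) / ((t%:C - z) * (t%:C - w)))).
    by rewrite /g; field; rewrite !nz ?hz.
  rewrite (le_trans (le_normcD _ _)) // [leRHS]mulrDl; apply: lerD; first exact: HL.
  rewrite normcN normcM normcR (ger0_norm (atom_weight_ge0 t)) -/D -mulrA.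
  apply: ler_wpM2l; first exact: atom_weight_ge0.
  rewrite normcM normcV normcM [_^-1 * _]mulrC; apply: ler_wpM2l; first exact: normc_ge0.
  rewrite lef_pV2 ?posrE ?exprn_gt0 ?mulr_gt0 ?(lt_le_trans c0 (hz _ cz)) ?(lt_le_trans c0 (hz _ cw)) //.
  by rewrite expr2; apply: ler_pM; rewrite ?(ltW c0) ?hz.
have g0 e : 0 < e -> 0 <= complex.Im (g (t +i* e)).
  move=> e0; rewrite Img // subrr /poisson_kernel expr0n add0r.
  have := atom_weight_le t e0; rewrite /scaled_im -/D => h.
  have -> : D * (e / e ^+ 2) = D / e by field; rewrite gt_eqF.
  by rewrite subr_ge0 ler_pdivrMr // mulrC.
pose l := rem t ts.
have tl : t \notin l by rewrite /l mem_rem_uniqF.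
have imE e : 0 < e -> im_without_poles f ts t e = complex.Im (g (t +i* e)) -
    \sum_(s <- l) atom_weight f s * poisson_kernel e (s - t).
  move=> e0; rewrite im_without_polesE // Img //.
  by rewrite (perm_big _ (perm_to_rem tts)) big_cons -/l -/D opprD addrA.
have lim0 := other_poles_vanish tl.
have [[y Hy]|Hinf] := Im_vertical_dichotomy t g_alg g_lip.
  have cy : complex.Im (g (t +i* e)) @[e --> 0^'+] --> y.
    by apply/cvgrPdist_lt => e e0; apply: filterS (Hy _ e0) => x; rewrite distrC.
  exists y%:E.
    rewrite lee_fin; apply: (cvgr_to_ge cy).
    by near=> e; apply: g0; near: e; exact: nbhs_right_gt.
  apply: cvg_EFin; first by near=> e.
  rewrite -[y]subr0; apply: cvg_trans (cvgB cy lim0); apply: near_eq_cvg; near=> e.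
  by rewrite /= imE //; near: e; exact: nbhs_right_gt.
exists +oo%E => //; apply/cvgeyPgt => M.
near=> e; rewrite lte_fin; have e0 : 0 < e by near: e; exact: nbhs_right_gt.
have h1 : M + 1 < complex.Im (g (t +i* e)).
  by rewrite -[ltRHS]ger0_norm ?g0 //; near: e; exact: Hinf.
have h2 : `|0 - \sum_(s <- l) atom_weight f s * poisson_kernel e (s - t)| < 1.
  by near: e; move/cvgrPdist_lt: lim0 => /(_ _ ltr01).
rewrite imE //; move: h2; rewrite sub0r normrN => h2.
have := ler_norm (\sum_(s <- l) atom_weight f s * poisson_kernel e (s - t)); lra.
Unshelve. all: by end_near. Qed.

Lemma density_ge0 (t : R) : (0 <= density f ts t)%E.
Proof.
have [L L0 HL] := im_without_poles_limit t.
rewrite /density (cvg_lim _ HL) // mule_ge0 // lee_fin invr_ge0.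
exact: pi_ge0.
Qed.

Lemma cvg_harmonic_right : @harmonic R n @[n --> \oo] --> 0^'+.
Proof.
move=> A /near_right0P [e e0 eA].
have := @cvg_harmonic R; move/cvgr_lt => /(_ _ e0); apply: filterS => n ne.
by apply: eA; rewrite ne andbT harmonic_gt0.
Qed.

Lemma measurable_im_without_poles (e : R) : 0 < e ->
  measurable_fun [set: R] (im_without_poles f ts ^~ e).
Proof.
move=> e0.
have -> : im_without_poles f ts ^~ e = (fun t => complex.Im (stieltjes mu (t +i* e)) -
    \sum_(s <- ts) atom_weight f s * poisson_kernel e (t - s)).
  apply/funext => t; rewrite im_without_polesE // fE //; congr (_ - _).
  by apply: eq_bigr => s _; rewrite /poisson_kernel -(sqrrN (s - t)) opprB.
apply: measurable_funB.
  by apply: continuous_measurable_fun; exact: continuous_Im_stieltjes.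
apply: measurable_sum => s; apply: measurable_funM => //.
exact: measurable_poisson.
Qed.

Lemma measurable_density : measurable_fun [set: R] (density f ts).
Proof.
apply: (@emeasurable_fun_cvg _ _ _ _
   (fun n t => (pi^-1)%:E * (im_without_poles f ts t (harmonic n))%:E)%E).
  move=> n; apply: emeasurable_funM => //; apply/measurable_EFinP.
  exact: (measurable_im_without_poles (harmonic_gt0 n)).
move=> t _; have [L L0 HL] := im_without_poles_limit t.
rewrite /density (cvg_lim _ HL) //; apply: cvgeZl => //.
apply: (@cvg_comp _ _ _ (@harmonic R) (fun e => (im_without_poles f ts t e)%:E) _ 0^'+ _
   cvg_harmonic_right HL).
Qed.

Lemma locally_bounded_nonsingular (t B : R) :
  (\forall e \near 0^'+, normc (f (t +i* e)) <= B) -> ~ sing_set f t.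
Proof.
move=> hB /sing_setP /(_ B) hs.
have : \forall e \near (0 : R)^'+, False.
  by apply: filterS2 hB hs => e /le_lt_trans h /h; rewrite ltxx.
by move=> /near_right0P [e e0 /(_ (e / 2))]; apply; lra.
Qed.

(** The boundary limit at [x] is taken over half-plane neighbourhoods, so [f] is bounded on a whole
    rectangle above an interval around [x]. Hence the interval has no singularity and inversion
    applies on it. *)
Lemma density_on_regular_interval (x : R) : ~ sing_set f x ->
  exists p q : R, [/\ p < x < q, `]p, q]%classic `<=` ~` [set` ts] &
     forall a b : R, p <= a -> b <= q -> a < b ->
       mu `]a, b]%classic = (\int[lambda]_(y in `]a, b]) density f ts y)%E].
Proof.
move=> nx; have [d d0 Hd] := bvP nx ltr01.
pose B := normc (bv x) + 1.
have bnd y e : x - d / 2 <= y <= x + d / 2 -> 0 < e < d / 2 -> normc (f (y +i* e)) <= B.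
  move=> /andP[y1 y2] /andP[e0 ed].
  have h : normc (f (y +i* e) - bv x) < 1.
    apply: Hd; first exact: e0.
    apply: le_lt_trans (normc_le _) _; rewrite /= subr0 (gtr0_norm e0).
    have : `|y - x| <= d / 2 by rewrite ler_norml; lra.
    lra.
  by have := le_normcD (f (y +i* e) - bv x) (bv x); rewrite subrK /B; lra.
have nons y : x - d / 2 <= y <= x + d / 2 -> ~ sing_set f y.
  move=> yd; apply: (@locally_bounded_nonsingular y B); apply/near_right0P.
  by exists (d / 2); [rewrite divr_gt0|move=> e ed; apply: bnd].
exists (x - d / 2), (x + d / 2); split; first lra.
  move=> y /=; rewrite in_itv /= => /andP[y1 y2] /tsP.
  by apply: nons; rewrite (ltW y1).
move=> a b pa bq ab.
have inI y : a <= y <= b -> x - d / 2 <= y <= x + d / 2.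
  by move=> /andP[ay yb]; rewrite (le_trans pa) // (le_trans yb).
have [|||||ig HI] := @stieltjes_inversion _ mu a b B (d / 2) (fun y => complex.Im (bv y)) ab.
- by rewrite divr_gt0.
- by apply/nonsingular_atom_weight/nons/inI; rewrite lexx ltW.
- by apply/nonsingular_atom_weight/nons/inI; rewrite lexx andbT ltW.
- move=> y e /inI yI ed; rewrite -fE; last by case/andP: ed.
  exact: le_trans (Im_le_normc _) (bnd _ _ yI ed).
- move=> y /inI /nons ny; have := @nonsingular_Im_cvg y ny.
  apply: cvg_trans; apply: near_eq_cvg; near=> e.
  by rewrite fE //; near: e; exact: nbhs_right_gt.
rewrite integral_itv_obnd_cbnd; last exact: measurable_funTS measurable_density.
have -> : (\int[lambda]_(y in `[a, b]) density f ts y =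
    \int[lambda]_(y in `[a, b]) ((pi^-1)%:E * (complex.Im (bv y))%:E))%E.
  apply: eq_integral => y; rewrite inE /= in_itv /= => /inI /nons ny.
  by rewrite nonsingular_density // EFinM.
rewrite integralZl // HI muleA -EFinM mulVf ?mul1e // gt_eqF //.
exact: pi_gt0.
Unshelve. all: by end_near. Qed.

Lemma measurable_seq (l : seq R) : measurable ([set` l] : set (measurableTypeR R)).
Proof.
elim: l => [|s l IH]; first by rewrite set_nil.
have -> : [set` s :: l] = [set s] `|` [set` l].
  apply/seteqP; split=> x /=; rewrite inE; first by move=> /orP[/eqP|]; [left|right].
  by move=> [->|->]; rewrite ?eqxx ?orbT.
exact: measurableU.
Qed.

Lemma measure_atoms (l : seq R) (B : set (measurableTypeR R)) : uniq l -> measurable B ->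
  mu (B `&` [set` l]) = (\sum_(s <- l) (atom_weight f s)%:E * \d_s B)%E.
Proof.
move=> + mB; elim: l => [|s l IH] /=.
  by move=> _; rewrite big_nil set_nil setI0 measure0.
move=> /andP[sl ul]; rewrite big_cons -IH //.
have -> : [set` s :: l] = [set s] `|` [set` l].
  apply/seteqP; split=> x /=; rewrite inE; first by move=> /orP[/eqP|]; [left|right].
  by move=> [->|->]; rewrite ?eqxx ?orbT.
have ml := measurable_seq l.
have ms := @measurable_set1 R s.
rewrite setIUr measureU; [|exact: measurableI|exact: measurableI|]; last first.
  apply/seteqP; split=> // x [[_ /= ->] [_ /=]].
  by rewrite (negPf sl).
congr (_ + _)%E; rewrite diracE atom_weightE.
have [sB|sB] := boolP (s \in B).
  rewrite mule1 fineK ?mu_fin //; congr (mu _).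
  by apply/setIidPr => x ->; move: sB; rewrite inE.
rewrite mule0; have -> : B `&` [set s] = set0; last by rewrite measure0.
by apply/seteqP; split=> // x [Bx /= xs]; move: sB; rewrite -xs notin_setE.
Qed.

(** Off [ts] the measure has the density, and on [ts] it is the sum of its atoms. The density may be
    infinite on [ts], but this finite set is Lebesgue null. *)
Lemma transform_decomposition : density_atoms_decomposition f mu ts.
Proof.
split.
- by move=> t _; apply: cvgP (@transform_scaled_im_cvg t).
- by move=> t; have [L _ HL] := im_without_poles_limit t; apply: cvgP HL.
- exact: density_ge0.
- exact: measurable_density.
move=> B mB.
have mt := measurable_seq ts.
have mU : measurable (~` [set` ts] : set (measurableTypeR R)) by exact: measurableC.
have mBU := measurableI _ _ mB mU; have mBt := measurableI _ _ mB mt.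
rewrite -measure_atoms // (measureDI mu mB mt) setDE; congr (_ + _)%E.
apply: etrans (measure_density_open measurable_density density_ge0 mU _ mB) _.
  move=> x /= xts; apply: density_on_regular_interval => sx; apply: xts; exact/tsP.
have {2}-> : B = (B `&` ~` [set` ts]) `|` (B `&` [set` ts]).
  by rewrite -setIUr setUC setUv setIT.
rewrite ge0_integral_setU //.
- rewrite [X in (_ + X)%E]null_set_integral ?adde0 //.
    exact: measurable_funTS measurable_density.
  apply: (subset_measure0 mBt mt) => //.
  by apply: countable_lebesgue_measure0; apply: finite_set_countable.
- exact: measurable_funTS measurable_density.
- by move=> x _; exact: density_ge0.
- by apply/disj_setPS => x [[_ +] [_]].
Qed.

End Decomposition.

(** * The regular support *)

Section FiniteUnion.
Context {R : realType}.

Lemma largest_below (L : seq R) (t : R) : t \notin L ->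
  (forall y, y \in L -> t < y) \/
  (exists2 x, x \in L & x < t /\ forall y, y \in L -> y < t -> y <= x).
Proof.
elim: L => [|a L IH]; first by left.
rewrite inE negb_or => /andP[ta /IH {}IH].
have [at_|ta'] := ltP a t; last first.
  have {}ta' : t < a by rewrite lt_neqAle ta.
  case: IH => [h|[x xL [xt hx]]]; [left|right].
    by move=> y; rewrite inE => /orP[/eqP ->//|]; exact: h.
  exists x; first by rewrite inE xL orbT.
  split=> // y; rewrite inE => /orP[/eqP ->|]; last exact: hx.
  by move=> /lt_trans /(_ ta'); rewrite ltxx.
right; case: IH => [h|[x xL [xt hx]]].
  exists a; first by rewrite inE eqxx.
  split=> // y; rewrite inE => /orP[/eqP ->//|/h /lt_trans h' /h'].
  by rewrite ltxx.
exists (Num.max a x); first by rewrite /Num.max; case: ifP; rewrite inE ?eqxx ?xL ?orbT.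
split; first by rewrite gt_max at_.
by move=> y; rewrite inE le_max => /orP[/eqP ->|yL yt]; rewrite ?lexx // hx ?orbT.
Qed.

Lemma smallest_above (L : seq R) (t : R) : t \notin L ->
  (forall y, y \in L -> y < t) \/
  (exists2 x, x \in L & t < x /\ forall y, y \in L -> t < y -> x <= y).
Proof.
move=> tL; have [|h|[x xL [xt hx]]] := @largest_below (map -%R L) (- t).
- by rewrite mem_map //; exact: oppr_inj.
- by left=> y yL; rewrite -ltrN2 h // map_f.
move: xL xt hx => /mapP [y yL ->]; rewrite ltrN2 => ty hx.
right; exists y => //; split => // z zL tz.
by rewrite -lerN2 hx ?ltrN2 // map_f.
Qed.

(** On an interval without points of [L] the set [U] is relatively open and closed, so by
    connectedness it contains the interval or misses it. A point of [L] in [U] receives a small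
    interval of its own. *)
Lemma finite_union_of_clopen (U : set R) (L : seq R) : open U ->
  (forall t, t \notin L -> ~ U t -> \forall s \near t, ~ U s) ->
  finite_union_open_intervals U.
Proof.
move=> oU HU.
pose lb : seq (itv_bound R) := -oo%O :: map (fun x => BRight x) L.
pose ub : seq (itv_bound R) := +oo%O :: map (fun x => BLeft x) L.
(* All pairs of endpoints are listed; unwanted intervals are harmless, since only those contained in
   [U] are kept. *)
pose I1 := [seq Interval a b | a <- lb, b <- ub].
pose I2 := [seq i <- I1 | `[< [set` i] `<=` U >]].
have nbU t : exists i : interval R, U t -> [/\ open [set` i], [set` i] `<=` U & t \in i].
  have [Ut|nUt] := pselect (U t); last by exists `]0, 0[.
  have /nbhs_ballP [e /= e0 eU] : nbhs t U by exact: open_nbhs_nbhs.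
  exists `](t - e), (t + e)[ => _; split.
  - exact: interval_open.
  - by move=> s /=; rewrite in_itv /= => /andP[h1 h2]; apply: eU; rewrite /ball /= ltr_norml; lra.
  - by rewrite in_itv /=; lra.
have [J HJ] := choice nbU.
exists (I2 ++ [seq J t | t <- L & `[< U t >]]); split.
  move=> i; rewrite mem_cat => /orP[|/mapP [t]].
    rewrite mem_filter => /andP[_ /allpairsP [[a b] /= [alb bub ->]]].
    apply: interval_open.
      by move: alb; rewrite inE => /orP[/eqP ->//|/mapP [x _ ->]].
    by move: bub; rewrite inE => /orP[/eqP ->//|/mapP [x _ ->]].
  by rewrite mem_filter => /andP[/asboolP Ut _ ->]; case: (HJ t Ut).
apply/seteqP; split=> [t Ut|t [i /= + ti]]; last first.
  rewrite mem_cat => /orP[|/mapP [s]].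
    by rewrite mem_filter => /andP[/asboolP iU _]; apply: iU.
  rewrite mem_filter => /andP[/asboolP Us _] iE.
  by case: (HJ s Us) => _ + _; apply; rewrite -iE.
have [tL|tL] := boolP (t \in L).
  exists (J t) => /=; last by case: (HJ t Ut).
  rewrite mem_cat; apply/orP; right; apply/mapP; exists t => //.
  by rewrite mem_filter tL andbT; apply/asboolP.
(* [a] and [b] are the neighbours of [t] in [L], infinite where there is none; [ha] and [hb] exclude
   any point of [L] in between. *)
have [a [alb at_ ha]] : exists a, [/\ a \in lb, (a <= BLeft t)%O &
    forall y, y \in L -> (a <= BLeft y)%O -> t < y].
  have [h|[x xL [xt hx]]] := largest_below tL.
    by exists -oo%O; split => // y yL _; exact: h.
  exists (BRight x); split; first by rewrite inE map_f ?orbT.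
    by rewrite bnd_simp.
  move=> y yL; rewrite bnd_simp => xy; rewrite ltNge; apply/negP => yt.
  have : y < t by rewrite lt_neqAle yt andbT; apply: contraNneq tL => <-.
  by move=> /(hx _ yL); rewrite leNgt xy.
have [b [bub tb hb]] : exists b, [/\ b \in ub, (BRight t <= b)%O &
    forall y, y \in L -> (BRight y <= b)%O -> y < t].
  have [h|[x xL [xt hx]]] := smallest_above tL.
    by exists +oo%O; split => // y yL _; exact: h.
  exists (BLeft x); split; first by rewrite inE map_f ?orbT.
    by rewrite bnd_simp.
  move=> y yL; rewrite bnd_simp => xy; rewrite ltNge; apply/negP => yt.
  have : t < y by rewrite lt_neqAle yt andbT; apply: contraNneq tL => ->.
  by move=> /(hx _ yL); rewrite leNgt xy.
pose i := Interval a b.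
have ti : t \in i by rewrite itv_boundlr at_ tb.
have iL s : s \in i -> s \notin L.
  rewrite itv_boundlr => /andP[as_ sb]; apply/negP => sL.
  by have := lt_trans (hb _ sL sb) (ha _ sL as_); rewrite ltxx.
exists i => //=; rewrite mem_cat; apply/orP; left.
rewrite mem_filter; apply/andP; split; last first.
  by apply/allpairsP; exists (a, b).
apply/asboolP.
have ci : connected [set` i] by apply/connected_intervalP; exact: interval_is_interval.
have <- : [set` i] `&` U = [set` i]; last by move=> s [].
apply: ci.
- by exists t.
- by exists U.
exists (~` (~` U)°); first by apply: open_closedC; exact: open_interior.
apply/seteqP; split=> s [si h]; split => //.
  by move=> /interior_subset; apply.
apply: contrapT => nUs; apply: h.
exact: HU (iL _ si) nUs.
Qed.

End FiniteUnion.

(** * Boundary values *)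

Section BoundaryFunction.
Context {R : realType}.
Local Notation C := R[i].
Local Notation H := (@upper_half_plane R).
Variable f : C -> C.
Hypothesis f_alg : algebraic_on H f.
Hypothesis f_lip : halfplane_lipschitz f.

Variable bv : R -> C.
Hypothesis bvP : forall t, ~ sing_set f t ->
  forall e : R, 0 < e -> near_point H t%:C (fun z => normc (f z - bv t) < e).

Lemma vertical_distance (s t e : R) : 0 < e ->
  normc (s +i* e - t%:C) <= `|s - t| + e.
Proof.
move=> e0; apply: le_trans (normc_le _) _; rewrite /= subr0 (gtr0_norm e0).
exact: lexx.
Qed.

(** Both boundary values are compared with [f] at one point [s +i* x], close to [s] and still within
    the neighbourhood that belongs to [t]. *)
Lemma boundary_continuous (t e : R) : ~ sing_set f t -> 0 < e ->
  exists2 d : R, 0 < d & forall s, ~ sing_set f s -> `|s - t| < d ->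
    normc (bv s - bv t) < e.
Proof.
move=> nt e0; have e20 : 0 < e / 2 by rewrite divr_gt0.
have [d d0 Hd] := bvP nt e20.
exists (d / 2); first by rewrite divr_gt0.
move=> s ns sd; have [d' d'0 Hd'] := bvP ns e20.
pose x := Num.min d d' / 3.
have m0 : 0 < Num.min d d' by rewrite lt_min d0.
have x0 : 0 < x by rewrite divr_gt0.
have xd : x < d / 2.
  have : Num.min d d' <= d by rewrite ge_min lexx.
  rewrite /x; lra.
have xd' : x < d'.
  have : Num.min d d' <= d' by rewrite ge_min lexx orbT.
  rewrite /x; lra.
have h1 : normc (f (s +i* x) - bv t) < e / 2.
  apply: Hd; first exact: x0.
  by apply: le_lt_trans (vertical_distance _ _ x0) _; lra.
have h2 : normc (f (s +i* x) - bv s) < e / 2.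
  apply: Hd'; first exact: x0.
  by apply: le_lt_trans (vertical_distance _ _ x0) _; rewrite subrr normr0 add0r.
have -> : bv s - bv t = - (f (s +i* x) - bv s) + (f (s +i* x) - bv t) by ring.
by apply: le_lt_trans (le_normcD _ _) _; rewrite normcN; lra.
Qed.

(** The spectral parameter and the unknown are moved separately to their limits. In [M],
    [2 + normc (bv t)] bounds [1 + normc (f z)] once [f z] is within 1 of [bv t]. *)
Lemma boundary_annihilator (P : {poly {poly C}}) (t : R) : ~ sing_set f t ->
  (forall z, H z -> P.[z%:P].[f z] = 0) -> P.[t%:C%:P].[bv t] = 0.
Proof.
move=> nt Pf; apply/eq0_normc/eqP; rewrite eq_le normc_ge0 andbT.
have [K [n [K0 HK]]] := poly2_lipschitz P t%:C.
have [B [B0 HB]] := poly_locally_lipschitz P.[t%:C%:P] (bv t).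
pose M := K * (2 + normc (bv t)) ^+ n + B.
have M0 : 0 <= M.
  by rewrite addr_ge0 // mulr_ge0 // exprn_ge0 // addr_ge0 ?normc_ge0.
apply/ler_addgt0Pl => e e0; rewrite addr0.
pose d := Num.min 1 (e / (M + 1)).
have M1 : 0 < M + 1 by rewrite ltr_wpDl.
have d0 : 0 < d by rewrite lt_min ltr01 divr_gt0.
have [d' d'0 Hd'] := bvP nt d0.
pose x := Num.min d d' / 2.
have m0 : 0 < Num.min d d' by rewrite lt_min d0.
have x0 : 0 < x by rewrite divr_gt0.
have xd : x < d.
  have : Num.min d d' <= d by rewrite ge_min lexx.
  rewrite /x; lra.
have xd' : x < d'.
  have : Num.min d d' <= d' by rewrite ge_min lexx orbT.
  rewrite /x; lra.
have d1 : d <= 1 by rewrite ge_min lexx.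
have zt : normc (t +i* x - t%:C) <= x.
  by apply: le_trans (vertical_distance _ _ x0) _; rewrite subrr normr0 add0r.
have fz : normc (f (t +i* x) - bv t) < d.
  by apply: Hd'; [exact: x0|exact: le_lt_trans zt xd'].
have h1 := HK (t +i* x) (f (t +i* x)) (le_trans zt (le_trans (ltW xd) d1)).
rewrite Pf ?sub0r ?normcN in h1; last exact: x0.
have h2 := HB _ (le_trans (ltW fz) d1).
have fb : normc (f (t +i* x)) <= 1 + normc (bv t).
  have := le_normcD (f (t +i* x) - bv t) (bv t); rewrite subrK.
  by move=> /le_trans; apply; rewrite lerD2r (le_trans (ltW fz)).
have h3 : normc P.[t%:C%:P].[f (t +i* x)] <= K * (2 + normc (bv t)) ^+ n * d.
  apply: le_trans h1 _; rewrite mulrAC; apply: ler_pM.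
  - by rewrite mulr_ge0 ?exprn_ge0 ?addr_ge0 ?normc_ge0.
  - exact: normc_ge0.
  - apply: ler_wpM2l => //; rewrite lerXn2r ?nnegrE ?addr_ge0 ?normc_ge0 //.
    lra.
  - exact: le_trans zt (ltW xd).
have h4 : normc (P.[t%:C%:P].[f (t +i* x)] - P.[t%:C%:P].[bv t]) <= B * d.
  by apply: le_trans h2 _; apply: ler_wpM2l => //; exact: ltW.
have -> : P.[t%:C%:P].[bv t] = P.[t%:C%:P].[f (t +i* x)] -
   (P.[t%:C%:P].[f (t +i* x)] - P.[t%:C%:P].[bv t]) by ring.
apply: le_trans (le_normcD _ _) _; rewrite normcN.
apply: le_trans (lerD h3 h4) _; rewrite -mulrDl -/M.
have : M * d <= M * (e / (M + 1)) by rewrite ler_wpM2l // /d ge_min lexx orbT.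
move=> /le_trans; apply; rewrite mulrA ler_pdivrMr // mulrC ler_wpM2l ?(ltW e0) //.
by rewrite lerDl.
Qed.

(* The polynomial annihilating [2i Im bv] is divided by the largest power of the
   unknown; its value at [0] then vanishes at finitely many points only, and away
   from these [Im bv = 0] and [Im bv <> 0] are separated. *)
Lemma boundary_Im_locally_zero : exists L : seq R, forall t, t \notin L ->
  ~ sing_set f t -> complex.Im (bv t) = 0 ->
  exists2 d : R, 0 < d & forall s, ~ sing_set f s -> `|s - t| < d ->
    complex.Im (bv s) = 0.
Proof.
have [P P0 Pf] := f_alg.
have Pbv t : ~ sing_set f t -> P.[t%:C%:P].[bv t] = 0.
  by move=> nt; exact: boundary_annihilator.
have [Q Q0 HQ] : exists2 Q : {poly {poly C}}, Q != 0 &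
    forall t, ~ sing_set f t -> Q.[t%:C%:P].[bv t - conjc (bv t)] = 0.
  have P20 : conj_poly2 P != 0 by rewrite conj_poly2_eq0.
  have [Q Q0 HQ] := annihilator_sub P0 P20.
  exists Q => // t nt; apply: (HQ _ _ _ (Pbv t nt)).
  have tJ : conjc t%:C = t%:C :> C by rewrite conjc_real.
  by rewrite -{1}tJ conj_poly2_horner Pbv // conjc0.
have sQ0 : swapXY Q != 0 by rewrite swapXY_eq0.
have [Q1 Q10 HQ1] := poly2_normalize 0 sQ0.
have {}HQ1 t : ~ sing_set f t -> complex.Im (bv t) != 0 ->
    Q1.[(bv t - conjc (bv t))%:P].[t%:C] = 0.
  move=> nt It; apply: HQ1; last by rewrite horner2_swapXY HQ.
  by rewrite subcJE eq_complex /= eqxx /= mulf_neq0.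
have [rs Hrs] := closed_field_poly_normal Q1.[0%:P].
exists (map (@complex.Re R) rs) => t tL nt It.
have q0 : Q1.[0%:P].[t%:C] != 0.
  apply: contraNneq tL => /eqP q0; apply/mapP; exists t%:C => //.
  by move: q0; rewrite -[_ == 0]/(root _ _) Hrs rootZ ?lead_coef_eq0 // root_prod_XsubC.
set c := normc Q1.[0%:P].[t%:C].
have c0 : 0 < c by exact: normc_gt0.
have [K [n [K0 HK]]] := poly2_lipschitz Q1 0.
have [B [B0 HB]] := poly_locally_lipschitz Q1.[0%:P] t%:C.
pose M := K * (2 + normc t%:C) ^+ n + B.
have M0 : 0 <= M.
  by rewrite addr_ge0 // mulr_ge0 // exprn_ge0 // addr_ge0 ?normc_ge0.
pose e := Num.min 1 (c / (M + 1)).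
have e0 : 0 < e by rewrite lt_min ltr01 divr_gt0 // ltr_wpDl.
have e1 : e <= 1 by rewrite ge_min lexx.
have Me : M * e < c.
  apply: le_lt_trans (_ : M * (c / (M + 1)) < _).
    by rewrite ler_wpM2l // /e ge_min lexx orbT.
  rewrite mulrA ltr_pdivrMr ?ltr_wpDl // mulrC ltr_pM2l //; lra.
have e20 : 0 < e / 2 by rewrite divr_gt0.
have [d d0 Hd] := boundary_continuous nt e20.
exists (Num.min d e); first by rewrite lt_min d0.
move=> s ns; rewrite lt_min => /andP[sd se].
apply/eqP; apply: contraT => Is.
have k0 := HQ1 s ns Is.
set k := bv s - conjc (bv s) in k0.
have ke : normc k <= e.
  rewrite normc_subJ; have := le_lt_trans (Im_le_normc _) (Hd s ns sd).
  have -> : complex.Im (bv s - bv t) = complex.Im (bv s).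
    by move: It; case: (bv s) (bv t) => a b [a' b'] /= ->; rewrite subr0.
  lra.
have st : normc (s%:C - t%:C) <= e.
  by rewrite -rmorphB normcR ltW.
have h1 := HK k s%:C; rewrite subr0 k0 sub0r normcN in h1.
have {}h1 := h1 (le_trans ke e1).
have h2 := HB s%:C (le_trans st e1).
have sb : normc s%:C <= 1 + normc t%:C.
  have := le_normcD (s%:C - t%:C) t%:C; rewrite subrK.
  by move=> /le_trans; apply; rewrite lerD2r (le_trans st).
have h3 : normc Q1.[0%:P].[s%:C] <= K * (2 + normc t%:C) ^+ n * e.
  apply: le_trans h1 _; rewrite mulrAC; apply: ler_pM.
  - by rewrite mulr_ge0 ?exprn_ge0 ?addr_ge0 ?normc_ge0.
  - exact: normc_ge0.
  - apply: ler_wpM2l => //; rewrite lerXn2r ?nnegrE ?addr_ge0 ?normc_ge0 //.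
    lra.
  - exact: ke.
have h4 : normc (Q1.[0%:P].[s%:C] - Q1.[0%:P].[t%:C]) <= B * e.
  by apply: le_trans h2 _; exact: ler_wpM2l.
have : c <= M * e.
  have -> : c = normc (Q1.[0%:P].[s%:C] - (Q1.[0%:P].[s%:C] - Q1.[0%:P].[t%:C])).
    by congr normc; ring.
  apply: le_trans (le_normcD _ _) _; rewrite normcN mulrDl; exact: lerD.
by rewrite leNgt Me.
Qed.

End BoundaryFunction.

(** * Continuous extension to the closed half-plane *)

Section Extension.
Context {R : realType}.
Local Notation C := R[i].
Local Notation H := (@upper_half_plane R).

Lemma near_normcP (z0 : R[i]^o) (A : C -> Prop) :
  (\forall z \near z0, A z) <->
  exists2 d : R, 0 < d & forall z, normc (z - z0) < d -> A z.
Proof.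
split=> [/nbhs_ballP [[e e'] /=]|[d d0 Hd]].
  rewrite ltcE /= => /andP[/eqP -> e0] eA; exists e => // z zd; apply: eA.
  rewrite /ball /= ltcE; move: zd; rewrite normcB.
  by case: (z0 - z) => a b /= ->; rewrite eqxx.
apply/nbhs_ballP; exists d%:C; first by rewrite /= ltcR.
move=> z; rewrite /ball /= ltcE => /andP[_ zd]; apply: Hd.
by rewrite normcB; move: zd; case: (z0 - z).
Qed.

Lemma within_continuousP (A : set R[i]^o) (g : R[i]^o -> R[i]^o) :
  {within A, continuous g} <-> forall z, A z -> forall e : R, 0 < e ->
    exists2 d : R, 0 < d & forall w, A w -> normc (w - z) < d -> normc (g w - g z) < e.
Proof.
split=> [/subspace_continuousP cg z Az e e0|h].
  have /cvg_normcP /(_ _ e0) := cg z Az.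
  rewrite /prop_near1 /within /= => /near_normcP [d d0 Hd].
  by exists d => // w Aw wz; exact: Hd.
apply/subspace_continuousP => z Az; apply/cvg_normcP => e e0.
have [d d0 Hd] := h z Az e e0.
by rewrite /prop_near1 /within /=; apply/near_normcP; exists d => // w wz Aw; exact: Hd.
Qed.

Variable f : C -> C.

(** Every point of the closed half-plane is approached vertically by points of the open one, where
    both extensions equal [f]. *)
Lemma continuous_extension_unique (g h : C -> C) :
  continuous_extension f g -> continuous_extension f h ->
  forall z, closed_upper_half_plane z -> g z = h z.
Proof.
move=> [/within_continuousP cg gf] [/within_continuousP ch hf] z Az.
apply/eqP; rewrite -subr_eq0; apply/eqP/eq0_normc/eqP; rewrite eq_le normc_ge0 andbT.
apply/ler_addgt0Pl => e e0; rewrite addr0.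
have e20 : 0 < e / 2 by rewrite divr_gt0.
have [d d0 Hd] := cg z Az _ e20; have [d' d'0 Hd'] := ch z Az _ e20.
pose x := Num.min d d' / 2.
have m0 : 0 < Num.min d d' by rewrite lt_min d0.
have x0 : 0 < x by rewrite divr_gt0.
have xd : x < d.
  have : Num.min d d' <= d by rewrite ge_min lexx.
  rewrite /x; lra.
have xd' : x < d'.
  have : Num.min d d' <= d' by rewrite ge_min lexx orbT.
  rewrite /x; lra.
pose w := z + 0 +i* x.
have Iw : complex.Im w = complex.Im z + x by rewrite /w; case: (z).
have wz : normc (w - z) = x.
  by rewrite /w addrC addKr /= expr0n add0r sqrtr_sqr gtr0_norm.
have Hw : H w by rewrite /upper_half_plane /= Iw ltr_wpDl.
have Aw : closed_upper_half_plane w by exact: ltW.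
have h1 : normc (g w - g z) < e / 2 by apply: Hd; rewrite ?wz.
have h2 : normc (h w - h z) < e / 2 by apply: Hd'; rewrite ?wz.
rewrite gf // in h1; rewrite hf // in h2.
have -> : g z - h z = - (f w - g z) + (f w - h z) by ring.
by apply: le_trans (le_normcD _ _) _; rewrite normcN; lra.
Qed.

Hypothesis f_lip : halfplane_lipschitz f.
Variable bv : R -> C.
Hypothesis bvP : forall t, ~ sing_set f t ->
  forall e : R, 0 < e -> near_point H t%:C (fun z => normc (f z - bv t) < e).

Lemma continuous_extension_exists : sing_set f = set0 ->
  exists g : C -> C, continuous_extension f g.
Proof.
move=> s0; have ns t : ~ sing_set f t by rewrite s0.
pose g z := if 0 < complex.Im z then f z else bv (complex.Re z).
exists g; split; last by move=> z Hz; rewrite /g Hz.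
apply/within_continuousP => z Az e e0.
have [Iz|Iz] := ltP 0 (complex.Im z).
  have Iz2 : 0 < complex.Im z / 2 by rewrite divr_gt0.
  have [L HL] := f_lip Iz2.
  have L0 : 0 < `|L| + 1 by rewrite ltr_wpDl.
  exists (Num.min (complex.Im z / 2) (e / (`|L| + 1))).
    by rewrite lt_min Iz2 divr_gt0.
  move=> w _; rewrite lt_min => /andP[w1]; rewrite ltr_pdivlMr // => w2.
  have Iw : complex.Im z / 2 <= complex.Im w.
    have := le_lt_trans (Im_le_normc _) w1.
    have -> : complex.Im (w - z) = complex.Im w - complex.Im z.
      by case: (w); case: (z).
    rewrite ltr_norml => /andP[h _]; lra.
  rewrite /g Iz (lt_le_trans Iz2 Iw).
  have zz : complex.Im z / 2 <= complex.Im z by lra.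
  apply: le_lt_trans (HL _ _ Iw zz) _; apply: le_lt_trans w2.
  rewrite mulrC ler_wpM2l ?normc_ge0 // (le_trans (ler_norm _)) //; lra.
have {Iz} Iz : complex.Im z = 0 by apply/eqP; rewrite eq_le Iz.
have zE : z = (complex.Re z)%:C by move: Iz; case: (z) => a b /= ->.
set t := complex.Re z in zE.
have [d d0 Hd] := bvP (ns t) e0.
have [d' d'0 Hd'] := boundary_continuous bvP (ns t) e0.
exists (Num.min d d'); first by rewrite lt_min d0.
move=> w Aw; rewrite lt_min => /andP[w1 w2].
have -> : g z = bv t by rewrite /g Iz ltxx.
rewrite /g; case: ifPn => Iw; first by apply: Hd => //; rewrite -zE.
apply: Hd' => //; apply: le_lt_trans w2; rewrite zE.
by apply: le_trans (Re_le_normc _); case: (w).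
Qed.

End Extension.

Section DensityContinuity.
Context {R : realType}.
Local Notation C := R[i].
Local Notation H := (@upper_half_plane R).
Variable f : C -> C.
Variable bv : R -> C.
Hypothesis bvP : forall t, ~ sing_set f t ->
  forall e : R, 0 < e -> near_point H t%:C (fun z => normc (f z - bv t) < e).

Lemma density_within_continuous (sing : set R) (v : R -> \bar R) :
  sing_set f `<=` sing ->
  (forall t, ~ sing_set f t -> v t = (pi^-1 * complex.Im (bv t))%:E) ->
  {within regular_support sing v, continuous v}.
Proof.
move=> fs vE; apply/subspace_continuousP => t [nt _].
have ns s : ~ sing s -> ~ sing_set f s by move=> h /fs.
rewrite /from_subspace [X in _ --> X]vE; last exact: ns.
apply: (@cvg_trans _ ((pi^-1 * complex.Im (bv s))%:E @[s --> within (regular_support sing v) (nbhs t)])).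
  apply: near_eq_cvg; rewrite /prop_near1 /within /=; apply: nearW => s [nns _].
  by rewrite vE //; exact: ns.
apply: cvg_EFin; first by near=> s.
apply/cvgrPdist_lt => e e0.
have pe : 0 < e * pi by rewrite mulr_gt0 // pi_gt0.
have [d d0 Hd] := boundary_continuous bvP (ns _ nt) pe.
rewrite /prop_near1 /within /=; apply/nbhs_ballP; exists d => //= s; rewrite /ball /= => sd [nns _].
rewrite -mulrBr normrM ger0_norm ?invr_ge0 ?pi_ge0 // mulrC ltr_pdivrMr ?pi_gt0 //.
rewrite distrC; apply: le_lt_trans (Hd s (ns _ nns) _); last by rewrite distrC.
apply: le_trans (Im_le_normc _).
by case: (bv s) (bv t) => ? ? [].
Unshelve. all: by end_near. Qed.

End DensityContinuity.

(** * The solution of the Dyson equation *)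

Section Dyson.
Context {R : realType} {d : nat}.
Local Notation C := R[i].
Local Notation H := (@upper_half_plane R).
Variables (S : 'M[R]_d) (a : 'rV[R]_d).
Hypothesis S_nonneg : nonneg_mx S.

(** Multiplying by the conjugate of [w] gives [|w|^2 g = - conjc w], whose imaginary part is the
    claim. *)
Lemma Im_of_inverse (w g : C) : w * g = -1 ->
  complex.Im w = normc w ^+ 2 * complex.Im g.
Proof.
case: w g => x y [u v] /eqP; rewrite eq_complex sqr_normcE /= oppr0.
move=> /andP[/eqP h1 /eqP h2].
have := congr1 (fun t => y * t) h1; have := congr1 (fun t => x * t) h2; lra.
Qed.

Lemma Im_sum (I : Type) (r : seq I) (F : I -> C) :
  complex.Im (\sum_(i <- r) F i) = \sum_(i <- r) complex.Im (F i).
Proof.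
elim: r => [|i r IH]; first by rewrite !big_nil.
by rewrite !big_cons -IH; case: (F i) => ? ?; case: (\sum_(_ <- _) _).
Qed.

Lemma normc_sum (I : Type) (r : seq I) (F : I -> C) :
  normc (\sum_(i <- r) F i) <= \sum_(i <- r) normc (F i).
Proof.
elim: r => [|i r IH]; first by rewrite !big_nil normc0.
by rewrite !big_cons (le_trans (le_normcD _ _)) // lerD2l.
Qed.

Lemma ImZ (x : R) (z : C) : complex.Im (x%:C * z) = x * complex.Im z.
Proof. by case: z => u v /=; ring. Qed.

Lemma dyson_Im (w : 'I_d -> C) (z : C) (i : 'I_d) :
  w i * (z - (a 0 i)%:C + \sum_j (S i j)%:C * w j) + 1 = 0 ->
  complex.Im (w i) =
    normc (w i) ^+ 2 * (complex.Im z + \sum_j S i j * complex.Im (w j)).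
Proof.
move=> /eqP; rewrite addr_eq0 => /eqP /Im_of_inverse ->; congr (_ * _).
have -> : complex.Im (z - (a 0 i)%:C + \sum_j (S i j)%:C * w j) =
    complex.Im z + complex.Im (\sum_j (S i j)%:C * w j).
  by case: z => x y; case: (\sum_j _) => u v /=; ring.
rewrite Im_sum; congr (_ + _); apply: eq_bigr => j _; exact: ImZ.
Qed.

(* With [v = Im m] the identity [dyson_Im] gives [|m|^2 S v < v], so that
   [1 - m^2 S] is injective by the maximum principle for [|h| / v]. *)
Lemma dyson_nondegenerate (w : 'I_d -> C) (z : C) : H z -> (forall i, H (w i)) ->
  (forall i, w i * (z - (a 0 i)%:C + \sum_j (S i j)%:C * w j) + 1 = 0) ->
  nondegenerate (map_mx (real_complex R) S) (fun i => z - (a 0 i)%:C) w.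
Proof.
move=> Hz Hw Hdy h Hh i0.
pose v i := complex.Im (w i).
have v0 i : 0 < v i by exact: Hw.
have vE i : v i = normc (w i) ^+ 2 * (complex.Im z + \sum_j S i j * v j).
  exact: dyson_Im (Hdy i).
(* The linearised equation times [w i], with the Dyson equation in the form [w i * g = -1], becomes
   [h = w^2 S h]. *)
have hE i : h i = w i ^+ 2 * \sum_j (S i j)%:C * h j.
  have := congr1 (fun x => w i * x) (Hh i); rewrite mulr0.
  have := Hdy i.
  under [X in _ -> _ * (_ * (_ + X) + _ * _) = _ -> _]eq_bigr do rewrite mxE.
  under [X in _ -> _ * (_ + _ * X) = _ -> _]eq_bigr do rewrite mxE.
  move: (\sum_j (S i j)%:C * w j) (\sum_j (S i j)%:C * h j) => s t.
  set g := z - _ + s => h1 h2.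
  have : h i * (w i * g + 1) = 0 by rewrite h1 mulr0.
  move=> h3.
  have -> : h i = h i * (w i * g + 1) - w i * (h i * g + w i * t) + w i ^+ 2 * t.
    by ring.
  by rewrite h3 h2 subr0 add0r.
have [i _ imax] := @arg_maxP _ _ _ i0 predT (fun i => normc (h i) / v i) isT.
set c := normc (h i) / v i in imax.
have c0 : 0 <= c by rewrite divr_ge0 ?normc_ge0 // ltW.
have hc j : normc (h j) <= c * v j by rewrite -ler_pdivrMr //; exact: imax.
have hic : normc (h i) = c * v i by rewrite /c mulfVK // gt_eqF.
have w0 : 0 < normc (w i) ^+ 2.
  by rewrite exprn_gt0 // (lt_le_trans (v0 i)) // (le_trans (ler_norm _)) // Im_le_normc.
have h1 : normc (h i) <= normc (w i) ^+ 2 * \sum_j S i j * (c * v j).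
  rewrite {1}hE normcM normcX; apply: ler_wpM2l; first exact: ltW.
  apply: le_trans (normc_sum _ _) _; apply: ler_sum => j _.
  by rewrite normcM normcR ger0_norm // ler_wpM2l.
have h2 : \sum_j S i j * (c * v j) = c * \sum_j S i j * v j.
  by rewrite mulr_sumr; apply: eq_bigr => j _; ring.
(* At the maximising index [c v_i <= |w_i|^2 c (S v)_i = c (v_i - |w_i|^2 Im z)], so [Im z > 0]
   forces [c = 0]. *)
have h3 : c * (normc (w i) ^+ 2 * complex.Im z) <= 0.
  have := vE i; move: h1; rewrite h2 hic; set s := \sum_j _; nra.
have c00 : c = 0.
  apply/eqP; rewrite eq_le c0 andbT leNgt; apply/negP => cp.
  have : 0 < c * (normc (w i) ^+ 2 * complex.Im z) by exact: (mulr_gt0 cp (mulr_gt0 w0 Hz)).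
  by rewrite ltNge h3.
apply/eq0_normc/eqP; rewrite eq_le normc_ge0 andbT.
by have := hc i0; rewrite c00 mul0r.
Qed.

(** Positivity travels backwards along a path from [i] to [j] in the graph of [S], by induction on
    its length: one positive neighbour makes [x i] positive. *)
Lemma irreducible_positive (x c : 'I_d -> R) : irreducible_mx S ->
  (forall i, 0 < c i) -> (forall i, 0 <= x i) ->
  (forall i, x i = c i * \sum_j S i j * x j) ->
  forall i j, 0 < x j -> 0 < x i.
Proof.
move=> Sirr c0 x0 xE i j xj; have [n _] := Sirr i j.
elim: n i => [|n IH] i.
  rewrite expr0 mxE; case: eqP => [-> //|_].
  by rewrite mulr0n ltxx.
rewrite exprS mxE => Sn.
have Sn0 k : 0 <= (S ^+ n) k j.
  elim: n {IH Sn} k => [|n IH] k; first by rewrite expr0 mxE; case: eqP.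
  by rewrite exprS mxE sumr_ge0 // => l _; rewrite mulr_ge0.
have [k Sik Snk] : exists2 k, 0 < S i k & 0 < (S ^+ n) k j.
  apply: contrapT => nk; move: Sn; rewrite big1 ?ltxx // => k _.
  apply/eqP; rewrite mulf_eq0; apply/orP.
  have [Sik|Sik] := ltP 0 (S i k); last by left; rewrite eq_le Sik S_nonneg.
  right; rewrite eq_le Sn0 andbT leNgt; apply/negP => h; apply: nk; by exists k.
rewrite xE mulr_gt0 // (bigD1 k) //= ltr_wpDr ?mulr_gt0 ?IH //.
by rewrite sumr_ge0 // => l _; rewrite mulr_ge0.
Qed.

End Dyson.

Section DysonSolution.
Context {R : realType} {d : nat}.
Local Notation C := R[i].
Local Notation H := (@upper_half_plane R).
Variables (S : 'M[R]_d) (a : 'rV[R]_d) (m : C -> 'rV[C]_d).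
Hypothesis S_nonneg : nonneg_mx S.
Hypothesis m_dyson : dyson_solution S a m.

Lemma dyson_solutionE (z : C) (i : 'I_d) : H z ->
  m z 0 i * (z - (a 0 i)%:C + \sum_j (S i j)%:C * m z 0 j) + 1 = 0.
Proof.
move=> Hz; have [mH mE] := m_dyson Hz.
rewrite -mE; have m0 : m z 0 i != 0.
  by apply: contraTneq (mH i) => ->; rewrite /upper_half_plane /= ltxx.
by rewrite div1r mulrN mulfV // addNr.
Qed.

Lemma dyson_algebraic (j : 'I_d) : algebraic_on H (fun z => m z 0 j).
Proof.
have [P P0 HP] := algebraic_solution (map_mx (real_complex R) S)
  (fun i => 'X - ((a 0 i)%:C)%:P) j.
exists (swapXY P); first by rewrite swapXY_eq0.
move=> z Hz; rewrite horner2_swapXY.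
apply: (HP z (fun i => m z 0 i)).
  move=> i; rewrite hornerXsubC -[RHS](dyson_solutionE i Hz); congr (_ * (_ + _) + _).
  by apply: eq_bigr => l _; rewrite mxE.
have -> : (fun i => ('X - ((a 0 i)%:C)%:P).[z]) = (fun i => z - (a 0 i)%:C).
  by apply/funext => i; rewrite hornerXsubC.
apply: dyson_nondegenerate => //.
  by move=> i; have [mH _] := m_dyson Hz; exact: mH.
by move=> i; exact: dyson_solutionE.
Qed.

Variable bv : 'I_d -> R -> C.
Hypothesis bvP : forall j t, ~ sing_set (fun z => m z 0 j) t ->
  forall e : R, 0 < e -> near_point H t%:C (fun z => normc (m z 0 j - bv j t) < e).

Lemma dyson_boundary (t : R) (i : 'I_d) :
  (forall j, ~ sing_set (fun z => m z 0 j) t) ->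
  bv i t * (t%:C - (a 0 i)%:C + \sum_j (S i j)%:C * bv j t) + 1 = 0.
Proof.
move=> nt.
have cm j : (m (t +i* e) 0 j : R[i]^o) @[e --> 0^'+] --> (bv j t : R[i]^o).
  by apply/cvg_normcP => e e0; exact: (near_point_vertical (bvP (nt j) e0)).
have cz : (t +i* e : R[i]^o) @[e --> 0^'+] --> (t%:C : R[i]^o).
  apply/cvg_normcP => e e0; apply: (@near_point_vertical _ t (fun z => normc (z - t%:C) < e)).
  by exists e.
have cs : (\sum_j (S i j)%:C * m (t +i* e) 0 j : R[i]^o) @[e --> 0^'+] -->
    (\sum_j (S i j)%:C * bv j t : R[i]^o).
  apply: (cvg_big (@add_continuous _)) => j _; apply: cvgM; [exact: cvg_cst|exact: cm].
have ct : (m (t +i* e) 0 i * (t +i* e - (a 0 i)%:C + \sum_j (S i j)%:C * m (t +i* e) 0 j) + 1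
   : R[i]^o) @[e --> 0^'+] -->
  (bv i t * (t%:C - (a 0 i)%:C + \sum_j (S i j)%:C * bv j t) + 1 : R[i]^o).
  apply: cvgD; last exact: cvg_cst.
  apply: cvgM; first exact: cm.
  apply: cvgD; last exact: cs.
  have ca : ((fun=> (a 0 i)%:C) x : R[i]^o) @[x --> (0:R)^'+] --> ((a 0 i)%:C : R[i]^o).
    exact: cvg_cst.
  exact: (cvgB cz ca).
apply: (cvg_unique (@norm_hausdorff _ _) ct); rewrite /=.
apply: cvg_near_cst; near=> e; apply: dyson_solutionE.
by rewrite /upper_half_plane /=; near: e; exact: nbhs_right_gt.
Unshelve. all: by end_near. Qed.

End DysonSolution.

Unset Implicit Arguments.

Theorem theorem2p3 (R : realType) (d : nat) (d_ge1 : (1 <= d)%N)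
    (S : 'M[R]_d) (a : 'rV[R]_d)
    (S_nonneg : nonneg_mx S) (S_irreducible : irreducible_mx S)
    (m : R[i] -> 'rV[R[i]]_d) (m_dyson : dyson_solution S a m)
    (nu : 'I_d -> probability (measurableTypeR R) R)
    (nu_stieltjes : forall (j : 'I_d) (z : R[i]), upper_half_plane z ->
       m z 0 j = stieltjes (nu j) z) :
  let mc (j : 'I_d) (z : R[i]) : R[i] := m z 0 j in
  let singA : set R := \bigcup_(j in [set: 'I_d]) sing_set (mc j) in
  [/\ forall j : 'I_d,
        [/\ sing_set (mc j) = im_sing_set (mc j),
            finite_set (sing_set (mc j)) &
            forall t : R, ~ sing_set (mc j) t -> has_boundary_value (mc j) t],
      (exists M : R, forall (z : R[i]) (i : 'I_d),
         upper_half_plane z -> normc (mc i z) <= M) ->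
      forall i : 'I_d,
        (exists g : R[i] -> R[i], continuous_extension (mc i) g) /\
        (forall g h : R[i] -> R[i],
           continuous_extension (mc i) g -> continuous_extension (mc i) h ->
           forall z : R[i], closed_upper_half_plane z -> g z = h z) &
      exists ts : 'I_d -> seq R,
        (forall j : 'I_d,
           [/\ uniq (ts j),
               forall t : R, t \in ts j -> sing_set (mc j) t &
               density_atoms_decomposition (mc j) (nu j) (ts j)]) /\
        let v (j : 'I_d) : R -> \bar R := density (mc j) (ts j) in
        (forall j : 'I_d,
           {within regular_support singA (v j), continuous (v j)}) /\
        exists frakS : set R,
          (forall j : 'I_d, regular_support singA (v j) = frakS) /\
          finite_union_open_intervals frakS].
Proof.
move=> mc singA.
pose H := @upper_half_plane R.
have fE j z : H z -> mc j z = stieltjes (nu j) z by exact: nu_stieltjes.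
have alg j : algebraic_on H (mc j) by exact: (dyson_algebraic S_nonneg m_dyson).
have lip j : halfplane_lipschitz (mc j) := transform_lipschitz (@fE j).
have fin j : finite_set (sing_set (mc j)) := sing_set_finite (alg j).
have bv_ex j t : exists l : R[i], ~ sing_set (mc j) t ->
    forall e : R, 0 < e -> near_point H t%:C (fun z => normc (mc j z - l) < e).
  (* At singular points the chosen value 0 is arbitrary. *)
  have [st|nst] := pselect (sing_set (mc j) t); first by exists 0.
  by have [l Hl] := nonsingular_limit (alg j) (lip j) nst; exists l.
have /choice [bv' Hbv'] := fun jt : 'I_d * R => bv_ex jt.1 jt.2.
pose bv j t := bv' (j, t).
have bvP j t : ~ sing_set (mc j) t ->
    forall e : R, 0 < e -> near_point H t%:C (fun z => normc (mc j z - bv j t) < e).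
  exact: (Hbv' (j, t)).
split.
- move=> j; split.
  + exact: (sing_set_im (alg j) (lip j) (transform_Im_ge0 (@fE j)) (transform_half (@fE j))).
  + exact: fin.
  + by move=> t nt; exact: (nonsingular_boundary_value (alg j) (lip j) nt).
- move=> [M HM] i.
  have s0 : sing_set (mc i) = set0.
    apply/seteqP; split=> // t st.
    apply: (@locally_bounded_nonsingular _ (mc i) t M) st.
    by near=> e; apply: HM; rewrite /upper_half_plane /=; near: e; exact: nbhs_right_gt.
  split; first exact: (continuous_extension_exists (lip i) (bvP i) s0).
  by move=> g h; exact: continuous_extension_unique.
have [sl Hsl] := choice (fun j => (finite_seqP _).1 (fin j)).
(* All singularities are listed as poles; those without mass get weight 0. *)
pose ts j := undup (sl j).
have tsP j t : t \in ts j <-> sing_set (mc j) t by rewrite Hsl mem_undup.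
have singAP t : ~ singA t <-> forall j, ~ sing_set (mc j) t.
  by split=> [nt j st|nt [j _]]; [apply: nt; exists j|exact: nt].
exists ts; split.
  move=> j; split; [exact: undup_uniq|by move=> t /tsP|].
  exact: (transform_decomposition (@fE j) (alg j) (bvP j) (undup_uniq _) (tsP j)).
move=> v.
have vE j t : ~ sing_set (mc j) t -> v j t = (pi^-1 * complex.Im (bv j t))%:E.
  by move=> nt; exact: (nonsingular_density (bvP j) (tsP j) nt).
split.
  move=> j; apply: (density_within_continuous (bvP j)); last exact: vE.
  by move=> t st; exists j.
pose j0 : 'I_d := Ordinal d_ge1.
pose U : set R := [set t | ~ singA t /\ 0 < complex.Im (bv j0 t)].
have Im_ge0 j t : ~ sing_set (mc j) t -> 0 <= complex.Im (bv j t).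
  move=> nt; apply: (cvgr_to_ge (@nonsingular_Im_cvg _ (mc j) (bv j) (bvP j) t nt)).
  near=> e; apply: (transform_Im_ge0 (@fE j)).
  by rewrite /upper_half_plane /=; near: e; exact: nbhs_right_gt.
(* At a real point the imaginary part of the equation is [Im m_i = |m_i|^2 \sum_j s_ij Im m_j], and
   the equation itself excludes [m_i = 0]. *)
have transfer t i j : ~ singA t -> 0 < complex.Im (bv j t) -> 0 < complex.Im (bv i t).
  move=> /singAP nt.
  have bE k := dyson_boundary m_dyson bvP k nt.
  apply: (@irreducible_positive _ _ S S_nonneg (fun k => complex.Im (bv k t))
    (fun k => normc (bv k t) ^+ 2) S_irreducible).
  - move=> k; rewrite exprn_gt0 // normc_gt0 //; apply: contra_eq_neq (bE k) => ->.
    by rewrite mul0r add0r oner_eq0.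
  - by move=> k; exact: Im_ge0.
  - by move=> k; rewrite {1}(dyson_Im (bE k)) /= add0r.
exists U; split.
  move=> j; apply/seteqP; split=> t [nt]; have nj := (singAP t).1 nt j.
    rewrite vE // lte_fin pmulr_rgt0 ?invr_gt0 ?pi_gt0 // => h.
    by split => //; exact: transfer h.
  move=> h; split=> //; rewrite vE // lte_fin pmulr_rgt0 ?invr_gt0 ?pi_gt0 //.
  exact: transfer h.
have singA_closed : closed singA.
  apply: closed_bigcup => [|j _]; first exact: finite_finset.
  exact: (accessible_finite_set_closed.1 (hausdorff_accessible (@Rhausdorff R))).
have [L HL] := boundary_Im_locally_zero (alg j0) (bvP j0).
(* The singularities of all components join the exceptional list: they lie outside [U] but may be
   limits of points of [U]. *)
apply: (@finite_union_of_clopen _ U (L ++ flatten [seq ts j | j <- enum 'I_d])).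
  rewrite openE => t [nt It]; have nj := (singAP t).1 nt j0.
  have [e e0 He] := boundary_continuous (bvP j0) nj It.
  have hA : \forall s \near t, ~ singA s by apply: open_nbhs_nbhs; split=> //; exact: closed_openC.
  rewrite /interior; near=> s; split; first by near: s.
  have ns : ~ singA s by near: s.
  have st : `|s - t| < e by rewrite distrC; near: s; exact: nbhsx_ballx.
  have := le_lt_trans (Im_le_normc _) (He s ((singAP s).1 ns j0) st).
  have -> : complex.Im (bv j0 s - bv j0 t) = complex.Im (bv j0 s) - complex.Im (bv j0 t).
    by case: (bv j0 s) (bv j0 t) => ? ? [].
  rewrite ltr_norml => /andP[h _]; lra.
move=> t; rewrite mem_cat negb_or => /andP[tL tts] nUt.
have nt : ~ singA t.
  move=> [j _ /tsP tj]; move/negP: tts; apply; apply/flattenP; exists (ts j) => //.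
  by apply: map_f; rewrite mem_enum.
have nj := (singAP t).1 nt j0.
have I0 : complex.Im (bv j0 t) = 0.
  apply/eqP; rewrite eq_le Im_ge0 // andbT leNgt; apply/negP => h; exact: nUt.
have [e e0 He] := HL t tL nj I0.
near=> s => -[ns].
have st : `|s - t| < e by rewrite distrC; near: s; exact: nbhsx_ballx.
by rewrite (He s ((singAP s).1 ns j0) st) ltxx.
Unshelve. all: by end_near. Qed.
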